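(* Let $\alpha\in(0,2)$, $\beta\in(-1,1)$, $A=A_{\alpha,\beta}$, $c\in\mathbb{R}$ and $\tau>0$. Define $U_\tau(\xi)=F_{\alpha\beta}(\xi\tau^{-1/\alpha})$ for $\xi\in\mathbb{R}$ and $u_{c\tau}(x,t)=U_\tau(x+ct)$. Then $u_{c\tau}$ is a travelling wave solution of $$\partial_t u_{c\tau}(x,t)+Au_{c\tau}(x,t)=c\,\tau^{-1/\alpha}g_0(u_{c\tau}(x,t))+\frac{1}{\alpha\tau}g_1(u_{c\tau}(x,t)),$$ where, for $\zeta\in(0,1)$, $$g_0(\zeta)=f_{\alpha\beta}(F_{\alpha\beta}^{-1}(\zeta)),\qquad g_1(\zeta)=F_{\alpha\beta}^{-1}(\zeta)\,f_{\alpha\beta}(F_{\alpha\beta}^{-1}(\zeta)).$$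
   Context: For $\alpha\in(0,2)$ and $\beta\in(-1,1)$ put $\rho=\alpha\beta$ if $\alpha<1$, $\rho=\beta$ if $\alpha=1$, $\rho=\beta(\alpha-2)$ if $\alpha>1$, and $p(\lambda)=e^{-i\frac{\pi}{2}\operatorname{sign}(\lambda)\rho}|\lambda|^\alpha$ for $\lambda\in\mathbb{R}$. Let $f_{\alpha\beta}$ be the (stable) probability density on $\mathbb{R}$ with characteristic function $\int_{\mathbb{R}}e^{i\lambda x}f_{\alpha\beta}(x)\,dx=e^{-p(\lambda)}$ and $F_{\alpha\beta}(x)=\int_{-\infty}^xf_{\alpha\beta}(s)\,ds$ its cumulative distribution function. It is known that $f_{\alpha\beta}$ is positive and infinitely differentiable, so $F_{\alpha\beta}:\mathbb{R}\to(0,1)$ is a bijection with inverse $F_{\alpha\beta}^{-1}$. $A=A_{\alpha,\beta}$ is the pseudo-differential operator acting in the variable $x$ with symbol $p$ (with the Fourier convention $\hat w(\lambda)=\int e^{i\lambda x}w(x)\,dx$). On the space $\mathcal{C}_{lim}$ of continuous functions on $\mathbb{R}$ having finite limits at $\pm\infty$ (with the supremum norm), $-A$ is understood as the infinitesimal generator of the $C_0$ semigroup $S(t)\varphi(x)=\int_{\mathbb{R}}t^{-1/\alpha}f_{\alpha\beta}\big(\tfrac{x-y}{t^{1/\alpha}}\big)\varphi(y)\,dy$ $(t>0)$, $S(0)\varphi=\varphi$, which solves $\partial_tu+Au=0$. The equation is understood for all $(x,t)\in\mathbb{R}\times\mathbb{R}$. *)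

(* Defs.v *)
From mathcomp Require Import all_boot all_order all_algebra.
From mathcomp Require Import complex.
From mathcomp Require Import all_classical all_reals all_analysis.

Set Implicit Arguments.
Unset Strict Implicit.
Unset Printing Implicit Defensive.

Import Order.TTheory GRing.Theory Num.Theory.
Import numFieldNormedType.Exports.

Local Open Scope classical_set_scope.
Local Open Scope ring_scope.

Section Complex.
Variable R : realType.
Local Open Scope complex_scope.

Definition cexp (z : R[i]) : R[i] :=
  (expR (complex.Re z) * cos (complex.Im z)) +i*
  (expR (complex.Re z) * sin (complex.Im z)).

Definition cintegral (w : R -> R[i]) : R[i] :=
  (\int[@lebesgue_measure R]_x complex.Re (w x)) +i*
  (\int[@lebesgue_measure R]_x complex.Im (w x)).

End Complex.

Section StableLaw.
Variable R : realType.
Implicit Types (alpha beta : R) (f : R -> R).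
Local Open Scope complex_scope.

Definition stable_rho alpha beta : R :=
  if alpha < 1 then alpha * beta
  else if alpha == 1 then beta
  else beta * (alpha - 2).

Definition stable_symbol alpha beta (l : R) : R[i] :=
  cexp (0 -i* (pi / 2 * Num.sg l * stable_rho alpha beta))
  * (`|l| `^ alpha)%:C.

(* The Lebesgue integral of the nonnegative function [f] is 1, so the integrals
   in [cintegral] below converge absolutely.  The characteristic function
   determines [f] only almost everywhere; continuity selects the smooth
   version. *)
Definition stable_density alpha beta f : Prop :=
  [/\ continuous f,
      forall x, 0 <= f x,
      (\int[@lebesgue_measure R]_x (f x)%:E = 1)%E &
      forall l : R,
        cintegral (fun x => cexp (0 +i* (l * x)) * (f x)%:C)
        = cexp (- stable_symbol alpha beta l)].

Definition cumul f (x : R) : R :=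
  \int[@lebesgue_measure R]_(s in `]-oo, x]) f s.

(* A right inverse of [cumul f] on its range: the inverse bijection
   from ]0, 1[ onto R when [f] is a positive density. *)
Definition cumul_inv f : R -> R := 'pinv_(fun=> 0) [set: R] (cumul f).

Definition g0 f (z : R) : R := f (cumul_inv f z).

Definition g1 f (z : R) : R := cumul_inv f z * f (cumul_inv f z).

End StableLaw.

Section Generator.
Variable R : realType.
Implicit Types (phi psi : R -> R).

Definition Clim : set (R -> R) :=
  [set phi | [/\ continuous phi, cvg (phi x @[x --> +oo])
               & cvg (phi x @[x --> -oo])]].

Definition sup_norm phi : \bar R := ereal_sup [set `|phi x|%:E | x in [set: R]].

Variable S : R -> (R -> R) -> (R -> R).

Definition is_generator phi psi : Prop :=
  [/\ Clim phi, Clim psi &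
      sup_norm (fun x => h^-1 * (S h phi x - phi x) - psi x)
        @[h --> 0^'+] --> 0%E].

Definition gen_dom : set (R -> R) := [set phi | exists psi, is_generator phi psi].

(* Meaningful on [gen_dom] only. *)
Definition generator phi : R -> R := get (is_generator phi).

End Generator.

Section TravellingWave.
Variable R : realType.
Implicit Types (alpha c : R) (f : R -> R).

Definition stable_semigroup alpha f (t : R) (phi : R -> R) : R -> R :=
  if t == 0 then phi else fun x =>
    \int[@lebesgue_measure R]_y
      (t `^ (- alpha^-1) * f ((x - y) / t `^ alpha^-1) * phi y).

Definition dom_A alpha f : set (R -> R) := gen_dom (stable_semigroup alpha f).

Definition opA alpha f (phi : R -> R) : R -> R :=
  fun x => - generator (stable_semigroup alpha f) phi x.

(* Travelling waves of speed [c] solving u_t + A u = G(u) on the whole of R x R,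
   for an operator [A] with domain [D]; [u x t] stands for u(x,t). *)
Definition travelling_wave_solution (D : set (R -> R))
    (A : (R -> R) -> (R -> R)) c (G : R -> R) (u : R -> R -> R) : Prop :=
  (exists U : R -> R, forall x t, u x t = U (x + c * t)) /\
  forall t, D (u^~ t) /\
    forall x, derivable (u x) t 1 /\
      derive1 (u x) t + A (u^~ t) x = G (u x t).

Definition U_profile alpha f (tau xi : R) : R :=
  cumul f (xi * tau `^ (- alpha^-1)).

End TravellingWave.

(* Main.v *)
Require Import Defs.
From HB Require Import structures.
From mathcomp Require Import all_boot all_order all_algebra.
From mathcomp Require Import complex.
From mathcomp Require Import all_classical all_reals all_analysis.
From mathcomp Require Import measurable_realfun.
From mathcomp Require Import ring lra.
Import Order.TTheory GRing.Theory Num.Theory.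
Import numFieldNormedType.Exports.
Local Open Scope classical_set_scope.
Local Open Scope ring_scope.
Set Implicit Arguments.
Unset Strict Implicit.
Unset Printing Implicit Defensive.

(** Let [f_t(x) = t^(-1/alpha) f(x t^(-1/alpha))] be the density [f] spread out
    to time [t], and [F] its cumulative function.  The profile at time [tau] is
    the cumulative function of [f_tau].  The symbol is homogeneous, so [f_t]
    has characteristic function [exp(-t p)], hence [f_s * f_t = f_(s+t)]
    ([stable_convolution]) and the semigroup moves profiles along a curve of
    profiles: [S(h)] sends [F(x tau^(-1/alpha))] to
    [F(x (tau+h)^(-1/alpha))] ([stable_semigroup_profile]).  Therefore [-A]
    applied to the profile is the derivative of this curve, namely
    [-(alpha tau)^(-1) y f(y)] at [y = x tau^(-1/alpha)]; this is the term in
    [g1], while the transport [x + c t] contributes the term in [g0].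

    The analytic content is that the difference quotients converge uniformly in
    [x], and that their limit belongs to the space of continuous functions with
    limits at both infinities.  Fourier inversion ([Fourier_inversion],
    proved by smoothing with the Poisson kernel) writes [f_t] as an oscillatory
    integral over the half-line.  One integration by parts ([stable_decay])
    turns [x f_t(x)] into an integral with integrand of size
    [l^(alpha-1) exp(-t a l^alpha)], integrable at both ends; its dependence on
    [t] is Lipschitz with a constant independent of [x]
    ([decay_Lipschitz]).  By the mean value theorem a difference quotient over a
    time [h] is the derivative at an intermediate time, hence within [K h] of
    the derivative at [tau] ([difference_quotient_bound]).  Each quotient tends
    to 0 at infinity, because [F] has limits there that do not depend on the
    dilation, so the uniform limit tends to 0 as well
    ([profile_generator_cvg0]).

    Finally, if [F] takes the same value at two points, it is constant between
    them and [f] vanishes at both ([cumul_level]).  So [g0] and [g1] evaluated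
    at [F(y)] give [f(y)] and [y f(y)], whichever preimage of [F(y)] the
    function [cumul_inv] selects. *)

(** * Affine changes of variable *)

Section AffineChange.
Context {R : realType}.
Notation mu := (@lebesgue_measure R).
Implicit Types a b : R.

(** The codomain is [measurableTypeR R] so that pushing forward the Lebesgue
    measure gives a measure on the sigma-algebra it is defined on. *)
Definition affine a b (x : R) : measurableTypeR R := a * x + b.

Lemma measurable_affine a b :
  measurable_fun [set: measurableTypeR R] (affine a b).
Proof.
apply: measurable_funD => //; exact: measurable_funM.
Qed.

(** Both sides are measures in [A] that agree on the intervals [`]u, v]]. *)
Lemma lebesgue_measure_affine a b (A : set (measurableTypeR R)) :
  a != 0 -> measurable A ->
  mu A = (`|a|%:E * mu (affine a b @^-1` A))%E.
Proof.
move=> a0 mA.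
pose k : {nonneg R} := NngNum (normr_ge0 a).
pose m : {measure set (measurableTypeR R) -> \bar R} :=
  mscale k (pushforward mu (affine a b)).
rewrite (@lebesgue_measure_unique R (m (measurable_affine a b))) // => X /ocitvP[->|].
  by rewrite !measure0.
case=> -[u v] /= uv ->; rewrite lebesgue_measure_itv /= lte_fin uv.
rewrite /mscale /= /pushforward /=.
have [a_lt0|a_gt0] : a < 0 \/ 0 < a.
  by move: a0; rewrite neq_lt => /orP[]; [left|right].
  have -> : affine a b @^-1` `]u, v] = `[(v - b) / a, (u - b) / a[%classic.
    apply/seteqP; split=> x /=; rewrite !in_itv/= /affine => /andP[h1 h2].
      by rewrite ler_ndivrMr// ltr_ndivlMr//; apply/andP; split; lra.
    move: h1 h2; rewrite ler_ndivrMr// ltr_ndivlMr// => h1 h2.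
    by apply/andP; split; lra.
  rewrite lebesgue_measure_itv /= lte_fin ltr_ndivlMr// mulfVK//.
  by rewrite ltrD2r uv -!EFinB -EFinM ltr0_norm//; congr EFin; field.
have -> : affine a b @^-1` `]u, v] = `](u - b) / a, (v - b) / a]%classic.
  apply/seteqP; split=> x /=; rewrite !in_itv/= /affine => /andP[h1 h2].
    by rewrite ltr_pdivrMr// ler_pdivlMr//; apply/andP; split; lra.
  move: h1 h2; rewrite ltr_pdivrMr// ler_pdivlMr// => h1 h2.
  by apply/andP; split; lra.
rewrite lebesgue_measure_itv /= lte_fin ltr_pM2r ?invr_gt0// ltrD2r uv.
by rewrite -!EFinB -EFinM gtr0_norm//; congr EFin; field.
Qed.

Lemma ge0_integral_affine a b (f : R -> \bar R) : a != 0 ->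
  measurable_fun [set: R] f -> (forall x, 0 <= f x)%E ->
  (\int[mu]_x f x = `|a|%:E * \int[mu]_x f (a * x + b)%R)%E.
Proof.
move=> a0 mf f0.
pose k : {nonneg R} := NngNum (normr_ge0 a).
pose m : {measure set (measurableTypeR R) -> \bar R} :=
  pushforward mu (affine a b).
pose m' := m (measurable_affine a b).
transitivity (\int[mscale k m']_x f x)%E.
  by apply: eq_measure_integral => A mA _; exact: lebesgue_measure_affine.
rewrite ge0_integral_mscale //= (ge0_integral_pushforward (measurable_affine a b)) //.
Qed.

Lemma integrable_affine a b (f : R -> R) : a != 0 ->
  mu.-integrable setT (EFin \o f) ->
  mu.-integrable setT (EFin \o (fun x => f (a * x + b))).
Proof.
move=> a0 /integrableP[mf fi]; apply/integrableP; split.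
  exact: (measurableT_comp mf (measurable_affine a b)).
move: fi; rewrite (ge0_integral_affine b a0) //; last exact: measurableT_comp.
apply: contraTT; rewrite -!leNgt !leye_eq => /eqP ->.
by rewrite gt0_muley // lte_fin normr_gt0.
Qed.

Lemma Rintegral_affine a b (f : R -> R) : a != 0 ->
  mu.-integrable setT (EFin \o f) ->
  \int[mu]_x f x = `|a| * \int[mu]_x f (a * x + b).
Proof.
move=> a0 fi; have mf := measurable_int _ fi.
have fia := integrable_affine b a0 fi.
rewrite /Rintegral -[X in _ = X * _]/(fine (`|a|%:E)) -fineM //; last first.
  exact: integrable_fin_num.
congr fine; rewrite integralE [in RHS]integralE muleBr //; last first.
  by apply: fin_num_adde_defl; rewrite fin_numN; exact: integrable_neg_fin_num.
congr (_ - _)%E; rewrite (ge0_integral_affine b a0) //.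
- by congr (_ * _)%E; apply: eq_integral => x _; rewrite !funeposE.
- exact: measurable_funepos.
- by congr (_ * _)%E; apply: eq_integral => x _; rewrite !funenegE.
- exact: measurable_funeneg.
Qed.

End AffineChange.

(** * Integrals of real functions *)

Section RealIntegrals.
Context d (T : measurableType d) (R : realType).
Variable mu : {measure set T -> \bar R}.
Implicit Types (D : set T) (f g : T -> R).

Lemma ler_integrable D f g : measurable D -> measurable_fun D f ->
  (forall x, D x -> `|f x| <= g x) ->
  mu.-integrable D (EFin \o g) -> mu.-integrable D (EFin \o f).
Proof.
move=> mD mf fg; apply: le_integrable => //; first exact/measurable_EFinP.
by move=> x Dx /=; rewrite lee_fin (le_trans (fg _ Dx)) // ler_norm.
Qed.

Lemma RintegrableZl D f (c : R) : measurable D ->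
  mu.-integrable D (EFin \o f) -> mu.-integrable D (EFin \o (fun x => c * f x)).
Proof. by move=> mD fi; have := integrableZl mD c fi. Qed.

Lemma RintegrableD D f g : measurable D ->
  mu.-integrable D (EFin \o f) -> mu.-integrable D (EFin \o g) ->
  mu.-integrable D (EFin \o (fun x => f x + g x)).
Proof. by move=> mD fi gi; have := integrableD mD fi gi. Qed.

Lemma RintegrableB D f g : measurable D ->
  mu.-integrable D (EFin \o f) -> mu.-integrable D (EFin \o g) ->
  mu.-integrable D (EFin \o (fun x => f x - g x)).
Proof. by move=> mD fi gi; have := integrableB mD fi gi. Qed.

Lemma Rdominated_cvg D (f_ : (T -> R)^nat) f g : measurable D ->
  (forall n, measurable_fun D (f_ n)) ->
  (forall x, D x -> f_ n x @[n --> \oo] --> f x) ->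
  mu.-integrable D (EFin \o g) ->
  (forall n x, D x -> `|f_ n x| <= g x) ->
  \int[mu]_(x in D) f_ n x @[n --> \oo] --> \int[mu]_(x in D) f x.
Proof.
move=> mD mf ff ig fg; apply: fine_cvg; rewrite fineK.
  apply: (@dominated_cvg _ _ _ mu _ mD (fun n x => (f_ n x)%:E) _ (EFin \o g)).
  - by move=> n; exact/measurable_EFinP.
  - by move=> x Dx; apply: cvg_EFin; [exact: nearW|exact: ff].
  - by [].
  - exact: ig.
  - by move=> n x Dx; rewrite lee_fin; exact: fg.
apply: integrable_fin_num => //.
apply: (ler_integrable mD _ _ ig) => [|x Dx].
  exact: (measurable_fun_cvg mf).
apply: (ler_cvg_to (cvg_norm (ff x Dx)) (cvg_cst (g x))).
by apply: nearW => n; exact: fg.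
Qed.

End RealIntegrals.

Section ProductDomination.
Context d1 d2 (T1 : measurableType d1) (T2 : measurableType d2) (R : realType).
Variables (m1 : {sigma_finite_measure set T1 -> \bar R}).
Variables (m2 : {sigma_finite_measure set T2 -> \bar R}).

Lemma integrable_prod_dominated (h : T1 * T2 -> R) (f : T1 -> R) (g : T2 -> R) :
  measurable_fun setT h ->
  m1.-integrable setT (EFin \o f) -> m2.-integrable setT (EFin \o g) ->
  (forall z, `|h z| <= `|f z.1| * `|g z.2|) ->
  (m1 \x m2)%E.-integrable setT (EFin \o h).
Proof.
move=> mh /integrableP[mf fi] /integrableP[mg gi] hfg.
have mh' : measurable_fun setT (EFin \o h) by exact/measurable_EFinP.
apply/(integrable12ltyP m1 m2 mh').
apply: (@le_lt_trans _ _
    (\int[m1]_x (`|(f x)%:E| * \int[m2]_y `|(g y)%:E|))%E).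
  apply: ge0_le_integral => //.
  - by move=> x _; exact: integral_ge0.
  - apply: (measurable_fun_fubini_tonelli_F (abse \o (EFin \o h))) => //=.
    exact: measurableT_comp.
  - by apply: emeasurable_funM => //; exact: measurableT_comp.
  move=> x _; rewrite -ge0_integralZl //; last exact: measurableT_comp.
  apply: ge0_le_integral => //.
  - apply: measurableT_comp => //.
    exact: (measurableT_comp mh' (measurable_pair1 x)).
  - by apply: emeasurable_funM => //; exact: measurableT_comp.
  - by move=> y _; rewrite lee_fin; exact: (hfg (x, y)).
rewrite ge0_integralZr //; last 2 first.
  exact: measurableT_comp.
  exact: integral_ge0.
by rewrite lte_mul_pinfty ?integral_ge0 // ge0_fin_numE // integral_ge0.
Qed.

End ProductDomination.

Section PhaseFubini.
Context {R : realType}.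
Notation mu := (@lebesgue_measure R).
Implicit Types (f w psi : R -> R) (D : set R).

Lemma measurable_cosin : measurable_fun [set: R] (@cos R) * measurable_fun [set: R] (@sin R).
Proof.
by split; apply: continuous_measurable_fun;
  [exact: continuous_cos|exact: continuous_sin].
Qed.

Lemma integrable_mul_cos D f (h : R -> R) : measurable D ->
  mu.-integrable D (EFin \o f) -> measurable_fun D h ->
  mu.-integrable D (EFin \o (fun x => f x * cos (h x))).
Proof.
move=> mD fi mh; have /measurable_EFinP mf := measurable_int _ fi.
apply: (@ler_integrable _ _ _ mu D _ (fun x => `|f x|)) => //; last exact: integrable_norm.
  by apply: measurable_funM => //; apply: measurableT_comp => //; exact: measurable_cosin.1.
by move=> x _ /=; rewrite normrM ler_piMr // ler_norml cos_geN1 cos_le1.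
Qed.

Lemma integrable_mul_sin D f (h : R -> R) : measurable D ->
  mu.-integrable D (EFin \o f) -> measurable_fun D h ->
  mu.-integrable D (EFin \o (fun x => f x * sin (h x))).
Proof.
move=> mD fi mh; have /measurable_EFinP mf := measurable_int _ fi.
apply: (@ler_integrable _ _ _ mu D _ (fun x => `|f x|)) => //; last exact: integrable_norm.
  by apply: measurable_funM => //; apply: measurableT_comp => //; exact: measurable_cosin.2.
by move=> x _ /=; rewrite normrM ler_piMr // ler_norml sin_geN1 sin_le1.
Qed.

Lemma Rintegral_mul_phase f (u l : R) : mu.-integrable setT (EFin \o f) ->
  \int[mu]_y (f y * cos (u + l * y)) =
  cos u * \int[mu]_y (f y * cos (l * y)) - sin u * \int[mu]_y (f y * sin (l * y)).
Proof.
move=> fi.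
have ml : measurable_fun [set: R] ( *%R l) by exact: measurable_funM.
have ic := integrable_mul_cos measurableT fi ml.
have is_ := integrable_mul_sin measurableT fi ml.
rewrite -!RintegralZl // -RintegralB //.
- by apply: eq_Rintegral => y _; rewrite cosD; ring.
- exact: RintegrableZl.
- exact: RintegrableZl.
Qed.

(** Integrating a cosine transform against [f] produces the Fourier transform
    of [f], because the phase is affine in [y].  This one exchange gives both
    the smoothing identity behind Fourier inversion and the convolution rule. *)
Lemma Fubini_phase D f w psi : measurable D ->
  mu.-integrable setT (EFin \o f) -> mu.-integrable D (EFin \o w) ->
  measurable_fun setT psi ->
  \int[mu]_y (f y * \int[mu]_(l in D) (w l * cos (psi l + l * y))) =
  \int[mu]_(l in D) (w l * (cos (psi l) * \int[mu]_y (f y * cos (l * y)) -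
                           sin (psi l) * \int[mu]_y (f y * sin (l * y)))).
Proof.
move=> mD fi wi mpsi.
(* Both variables must range over the whole line for Fubini's theorem. *)
pose w' : R -> R := w \_ D.
have w'i : mu.-integrable setT (EFin \o w').
  by rewrite /w' -restrict_EFin; exact: (@integrable_mkcond _ _ _ mu D (EFin \o w) mD).1 wi.
have /measurable_EFinP mf := measurable_int _ fi.
have /measurable_EFinP mw' := measurable_int _ w'i.
pose k (z : R * R) : R := cos (psi z.2 + z.2 * z.1).
pose h (z : R * R) : R := f z.1 * (w' z.2 * k z).
have EL y : (\int[mu]_l (EFin \o h) (y, l))%E =
    (f y * \int[mu]_(l in D) (w l * cos (psi l + l * y)))%:E.
  have iy : mu.-integrable setT (EFin \o (fun l => w' l * cos (psi l + l * y))).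
    apply: integrable_mul_cos => //.
    by apply: measurable_funD => //; exact: measurable_funM.
  rewrite Rintegral_mkcond EFinM /Rintegral fineK; last first.
    apply: integrable_fin_num => //; apply: eq_integrable iy => // l _ /=.
    by rewrite /w' !patchE; case: ifP => // _; rewrite mul0r.
  rewrite -integralZl //; last first.
    apply: eq_integrable iy => // l _ /=.
    by rewrite /w' !patchE; case: ifP => // _; rewrite mul0r.
  apply: eq_integral => l _; rewrite /h /k /= -EFinM /w' !patchE.
  by case: ifP => // _; rewrite !mul0r.
have ER l : (\int[mu]_y (EFin \o h) (y, l))%E =
    (w' l * (cos (psi l) * \int[mu]_y (f y * cos (l * y)) -
             sin (psi l) * \int[mu]_y (f y * sin (l * y))))%:E.
  rewrite -Rintegral_mul_phase // EFinM /Rintegral.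
  have il : mu.-integrable setT (EFin \o (fun y => f y * cos (psi l + l * y))).
    apply: integrable_mul_cos => //.
    by apply: measurable_funD => //; exact: measurable_funM.
  rewrite fineK; last exact: integrable_fin_num.
  rewrite -integralZl //; apply: eq_integral => y _.
  by rewrite /h /k /= -EFinM; congr EFin; ring.
have mk : measurable_fun setT k.
  apply: (measurableT_comp measurable_cosin.1).
  apply: measurable_funD; first exact: (measurableT_comp mpsi measurable_snd).
  exact: measurable_funM.
have mh : measurable_fun setT (EFin \o h).
  apply/measurable_EFinP; apply: measurable_funM.
    exact: (measurableT_comp mf measurable_fst).
  apply: measurable_funM => //; exact: (measurableT_comp mw' measurable_snd).
have k1 z : `|k z| <= 1 by rewrite ler_norml cos_geN1 cos_le1.
have ih : (mu \x mu)%E.-integrable setT (EFin \o h).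
  apply: (@integrable_prod_dominated _ _ _ _ _ mu mu h f w') => //.
    exact/measurable_EFinP.
  by move=> z; rewrite /h mulrA !normrM ler_piMr ?mulr_ge0.
have F := Fubini ih.
transitivity (fine (\int[mu]_y \int[mu]_l (EFin \o h) (y, l))%E).
  by rewrite /Rintegral; congr fine; apply: eq_integral => y _; rewrite EL.
rewrite F {F ih} [RHS]Rintegral_mkcond /Rintegral; congr fine.
apply: eq_integral => l _; rewrite ER; congr EFin.
by rewrite /w' !patchE; case: ifP => // _; rewrite mul0r.
Qed.

End PhaseFubini.

(** * The fundamental theorem of calculus on the half-line *)

Section HalfLineFTC.
Context {R : realType}.
Notation mu := (@lebesgue_measure R).
Notation pos := (`]0, +oo[%classic : set R).
Variables (f F : R -> R).
Hypothesis dF : forall x : R, 0 < x -> is_derive x 1 F (f x).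
Hypothesis cf : forall x : R, 0 < x -> {for x, continuous f}.

(** Compact intervals exhausting the open half-line; the upper end [n + 2]
    keeps them nondegenerate for [n = 0]. *)
Let J (n : nat) : set R := `[n.+1%:R^-1, n.+2%:R]%classic.

Let J_lt n : (n.+1%:R^-1 : R) < n.+2%:R.
Proof.
apply: (@le_lt_trans _ _ 1); last by rewrite ltr1n.
by rewrite invf_le1 ?ltr0n // ler1n.
Qed.

Let J_pos n x : J n x -> 0 < x.
Proof.
by rewrite /J /= in_itv /= => /andP[h _]; apply: lt_le_trans h; rewrite invr_gt0.
Qed.

Let J_homo : {homo J : n m / (n <= m)%N >-> (n <= m)%O}.
Proof.
move=> n m nm; apply/subsetPset => x; rewrite /J /= !in_itv /= => /andP[h1 h2].
apply/andP; split; last by rewrite (le_trans h2) // ler_nat ltnS.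
by apply: le_trans h1; rewrite lef_pV2 ?posrE ?ltr0n // ler_nat ltnS.
Qed.

Let J_eventually (x : R) : 0 < x -> \forall n \near \oo, J n x.
Proof.
move=> x0; near=> n; rewrite /J /= in_itv /=; apply/andP; split.
  by apply/ltW; near: n; exact: (near_infty_natSinv_lt (PosNum x0)).
apply: (@le_trans _ _ n%:R); last by rewrite ler_nat (leqW (leqnSn n)).
by near: n; exact: nbhs_infty_ger.
Unshelve. all: by end_near. Qed.

Let bigcupJ : \bigcup_n J n = pos.
Proof.
apply/seteqP; split=> [x [n _ Jx]|x].
  by rewrite /= in_itv /= (J_pos Jx).
rewrite /= in_itv /= andbT => /J_eventually [n _ /(_ n (leqnn n)) h].
by exists n.
Qed.

Let J_FTC2 n : (\int[mu]_(x in J n) (f x)%:E = (F n.+2%:R - F n.+1%:R^-1)%:E)%E.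
Proof.
have inv0 : 0 < (n.+1%:R^-1 : R) by rewrite invr_gt0.
have cF x : 0 < x -> {for x, continuous F}.
  by move=> x0; apply/differentiable_continuous/derivable1_diffP; case: (dF x0).
rewrite EFinB; apply: continuous_FTC2 => //.
- apply: continuous_in_subspaceT => x /set_mem /J_pos; exact: cf.
- split.
  + move=> x /subset_itv_oo_cc xJ.
    by case: (dF (@J_pos n x xJ)).
  + by apply: cvg_at_right_filter; exact: cF.
  + by apply: cvg_at_left_filter; apply: cF; rewrite ltr0n.
- move=> x /subset_itv_oo_cc xJ; rewrite derive1E.
  by apply: derive_val; exact: (dF (@J_pos n x xJ)).
Qed.

Let J_FTC2_cvg (l0 l1 : R) : F x @[x --> 0^'+] --> l0 -> F x @[x --> +oo] --> l1 ->
  F n.+2%:R - F n.+1%:R^-1 @[n --> \oo] --> l1 - l0.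
Proof.
move=> /cvg_at_rightP F0 /cvg_pinftyP F1; apply: cvgB.
  apply: F1; apply/cvgryPge => A; near=> n.
  apply: (@le_trans _ _ n%:R); last by rewrite ler_nat (leqW (leqnSn n)).
  by near: n; exact: nbhs_infty_ger.
apply: (F0 (fun n => n.+1%:R^-1)); split; first by move=> n; rewrite invr_gt0.
exact: cvg_harmonic.
Unshelve. all: by end_near. Qed.

Let mf : measurable_fun pos f.
Proof.
apply: open_continuous_measurable_fun; first exact: interval_open.
by move=> x /set_mem /=; rewrite in_itv /= andbT; exact: cf.
Qed.

Lemma ge0_FTC_halfline (l0 l1 : R) : (forall x : R, 0 < x -> 0 <= f x) ->
  F x @[x --> 0^'+] --> l0 -> F x @[x --> +oo] --> l1 ->
  (\int[mu]_(x in pos) (f x)%:E = (l1 - l0)%:E)%E.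
Proof.
move=> f0 F0 F1; have h := J_FTC2_cvg F0 F1.
have : (\int[mu]_(x in J n) (f x)%:E @[n --> \oo] --> \int[mu]_(x in pos) (f x)%:E)%E.
  rewrite -bigcupJ; apply: ge0_nondecreasing_set_cvg_integral => //.
  - by move=> i; exact: measurable_itv.
  - move=> i; apply/measurable_EFinP.
    apply: measurable_funS mf => //; rewrite -bigcupJ; exact: bigcup_sup.
  - by move=> i x /J_pos x0; rewrite lee_fin f0.
under eq_fun do rewrite J_FTC2.
move=> hc; apply: (cvg_unique (@ereal_hausdorff R) hc).
by apply: cvg_EFin; [exact: nearW|exact: h].
Qed.

Lemma ge0_halfline_integrable (l0 l1 : R) : (forall x : R, 0 < x -> 0 <= f x) ->
  F x @[x --> 0^'+] --> l0 -> F x @[x --> +oo] --> l1 ->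
  mu.-integrable pos (EFin \o f).
Proof.
move=> f0 F0 F1; apply/integrableP; split; first exact/measurable_EFinP.
rewrite (_ : integral _ _ _ = (l1 - l0)%:E) ?ltry //.
rewrite -(ge0_FTC_halfline f0 F0 F1); apply: eq_integral => x.
by rewrite inE /= in_itv /= andbT => x0; rewrite ger0_norm // f0.
Qed.

(** Without a sign condition the limit along the exhaustion is taken by
    dominated convergence, so integrability has to be known beforehand. *)
Lemma FTC_halfline (l0 l1 : R) : mu.-integrable pos (EFin \o f) ->
  F x @[x --> 0^'+] --> l0 -> F x @[x --> +oo] --> l1 ->
  \int[mu]_(x in pos) f x = l1 - l0.
Proof.
move=> fi F0 F1; have h := J_FTC2_cvg F0 F1.
have : \int[mu]_(x in pos) ((f \_ (J n)) x) @[n --> \oo] --> \int[mu]_(x in pos) f x.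
  apply: (@Rdominated_cvg _ _ _ mu pos _ _ (fun x => `|f x|)) => //.
  - move=> n; apply/measurable_restrict => //.
    + exact: measurable_itv.
    + by apply: measurable_funS mf => // x [].
  - move=> x /=; rewrite in_itv /= andbT => x0.
    apply: cvg_near_cst; near=> n; rewrite patchE mem_set //.
    by near: n; exact: J_eventually.
  - exact: integrable_norm.
  - by move=> n x _; rewrite patchE; case: ifP => // _; rewrite normr0.
have -> : (fun n => \int[mu]_(x in pos) ((f \_ (J n)) x)) =
          (fun n => F n.+2%:R - F n.+1%:R^-1).
  apply/funext => n; rewrite -Rintegral_mkcondr setIidr; last first.
    by rewrite -bigcupJ; exact: bigcup_sup.
  by rewrite /Rintegral J_FTC2.
by move=> hc; exact: (cvg_unique (@Rhausdorff R) hc).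
Unshelve. all: by end_near. Qed.

End HalfLineFTC.

(** * The Poisson kernel *)

Section Derivation.
Context {R : realType}.
Implicit Types (f g : R -> R) (x a b : R).

Lemma is_derive_mul f g x a b : is_derive x 1 f a -> is_derive x 1 g b ->
  is_derive x 1 (fun y => f y * g y) (f x * b + g x * a).
Proof. by move=> df dg; exact: is_deriveM. Qed.

Lemma is_derive_sub f g x a b : is_derive x 1 f a -> is_derive x 1 g b ->
  is_derive x 1 (fun y => f y - g y) (a - b).
Proof. by move=> df dg; exact: is_deriveB. Qed.

Lemma is_derive_scale c f x a : is_derive x 1 f a ->
  is_derive x 1 (fun y => c * f y) (c * a).
Proof.
by move=> df; apply: is_derive_eq (is_derive_mul (is_derive_cst c x 1) df) _;
  rewrite mulr0 addr0.
Qed.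

Lemma is_derive_exp f x a : is_derive x 1 f a ->
  is_derive x 1 (fun y => expR (f y)) (expR (f x) * a).
Proof. by move=> df; exact: is_derive1_comp. Qed.

Lemma is_derive_cosin f x a : is_derive x 1 f a ->
  is_derive x 1 (fun y => cos (f y)) (- sin (f x) * a) *
  is_derive x 1 (fun y => sin (f y)) (cos (f x) * a).
Proof. by move=> df; split; exact: is_derive1_comp. Qed.

Lemma is_derive_continuous f x a : is_derive x 1 f a -> {for x, continuous f}.
Proof. by move=> df; apply/differentiable_continuous/derivable1_diffP. Qed.

Lemma is_derive_linear c x : is_derive x 1 ( *%R c) c.
Proof. by apply: is_derive_eq (is_derive_scale c (is_derive_id x 1)) _; rewrite mulr1. Qed.

End Derivation.

Section PoissonKernel.
Context {R : realType}.
Notation mu := (@lebesgue_measure R).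
Notation pos := (`]0, +oo[%classic : set R).
Implicit Types (e z l : R).

Lemma cvg_expRN e : 0 < e -> expR (- e * l) @[l --> +oo] --> 0.
Proof.
move=> e0; under eq_fun do rewrite mulNr.
apply: (cvg_comp _ _ _ (@cvgr_expR R)).
by apply: gt0_cvgMry => //; exact: cvg_id.
Qed.

Let d_exp e l : is_derive l 1 (fun l => expR (- e * l)) (expR (- e * l) * - e).
Proof. exact: is_derive_exp (is_derive_linear (- e) l). Qed.

Lemma integrable_expRN e : 0 < e ->
  mu.-integrable pos (EFin \o (fun l => expR (- e * l))).
Proof.
move=> e0.
have dF l : is_derive l 1 (fun l => - e^-1 * expR (- e * l)) (expR (- e * l)).
  apply: is_derive_eq (is_derive_scale (- e^-1) (d_exp e l)) _.
  by field; rewrite gt_eqF.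
apply: (@ge0_halfline_integrable _ _ _ _ _ (- e^-1 * expR (- e * 0)) (- e^-1 * 0)).
- by move=> l _; exact: is_derive_continuous (d_exp e l).
- by move=> l _; exact: expR_ge0.
- by apply: cvg_at_right_filter; exact: is_derive_continuous (dF 0).
- by apply: cvgMr; exact: cvg_expRN.
Qed.

(** The Poisson kernel is the cosine transform of a decaying exponential. *)
Lemma Laplace_cos e z : 0 < e ->
  \int[mu]_(l in pos) (expR (- e * l) * cos (z * l)) = e / (e ^+ 2 + z ^+ 2).
Proof.
move=> e0.
have ez0 : e ^+ 2 + z ^+ 2 != 0.
  by rewrite gt_eqF // ltr_wpDr ?sqr_ge0 ?exprn_gt0.
pose s := (e ^+ 2 + z ^+ 2)^-1.
(* The antiderivative is the real part of [exp((- e + i z) l) / (- e + i z)]. *)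
pose q l := z * sin (z * l) + - e * cos (z * l).
pose F l := s * (expR (- e * l) * q l).
have dq l : is_derive l 1 q (z * (cos (z * l) * z) + - e * (- sin (z * l) * z)).
  have [dc ds] := is_derive_cosin (is_derive_linear z l).
  exact: is_deriveD (is_derive_scale z ds) (is_derive_scale (- e) dc).
have dF l : is_derive l 1 F (expR (- e * l) * cos (z * l)).
  apply: is_derive_eq (is_derive_scale s (is_derive_mul (d_exp e l) (dq l))) _.
  by rewrite /q /s; field.
have F1 : F l @[l --> +oo] --> 0.
  rewrite -(mulr0 s); apply: cvgMr.
  pose M := `|z| + e.
  have h1 : M * expR (- e * l) @[l --> +oo] --> 0.
    by rewrite -(mulr0 M); apply: cvgMr; exact: cvg_expRN.
  have h2 : - (M * expR (- e * l)) @[l --> +oo] --> 0.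
    by rewrite -oppr0; exact: cvgN.
  apply: (squeeze_cvgr _ h2 h1); apply: nearW => l.
  rewrite -ler_norml normrM (ger0_norm (expR_ge0 _)) mulrC ler_wpM2r ?expR_ge0 //.
  apply: (le_trans (ler_normD _ _)); rewrite !normrM normrN (gtr0_norm e0).
  apply: lerD; [|apply: ler_piMr; first exact: ltW].
    by apply: ler_piMr => //; rewrite ler_norml sin_geN1 sin_le1.
  by rewrite ler_norml cos_geN1 cos_le1.
rewrite (@FTC_halfline _ _ F _ _ (F 0) 0) //.
- by rewrite /F /q !mulr0 sin0 cos0 expR0 /s; field.
- move=> l _; have [dc _] := is_derive_cosin (is_derive_linear z l).
  exact: is_derive_continuous (is_derive_mul (d_exp e l) dc).
- by apply: integrable_mul_cos => //; exact: integrable_expRN.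
- by apply: cvg_at_right_filter; exact: is_derive_continuous (dF 0).
Qed.

Notation cauchy := (fun u : R => (oneDsqr u)^-1).

Lemma integral_cauchy : (\int[mu]_u (cauchy u)%:E = pi%:E)%E.
Proof.
rewrite ge0_symfun_integralT.
- by rewrite -set_itvcy integral0y_oneDsqr -EFinM mulrC divfK.
- by move=> x; rewrite invr_ge0 (le_trans ler01 (oneDsqr_ge1 x)).
- exact: continuous_oneDsqrV.
- by move=> x /=; rewrite /oneDsqr sqrrN.
Qed.

Lemma cauchy_gt0 u : 0 < cauchy u.
Proof. by rewrite invr_gt0 (lt_le_trans ltr01 (oneDsqr_ge1 u)). Qed.

Lemma measurable_cauchy : measurable_fun [set: R] cauchy.
Proof. by apply: continuous_measurable_fun; exact: continuous_oneDsqrV. Qed.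

Lemma integrable_cauchy : mu.-integrable setT (EFin \o cauchy).
Proof.
apply/integrableP; split.
  by apply/measurable_EFinP; exact: measurable_cauchy.
rewrite (_ : integral _ _ _ = pi%:E) ?ltry // -integral_cauchy.
by apply: eq_integral => x _; rewrite /= ger0_norm // ltW // cauchy_gt0.
Qed.

End PoissonKernel.

(** * Fourier inversion for densities *)

Section FourierInversion.
Context {R : realType}.
Notation mu := (@lebesgue_measure R).
Notation pos := (`]0, +oo[%classic : set R).
Notation cauchy := (fun u : R => (oneDsqr u)^-1).
Variable f : R -> R.
Hypotheses (cf : continuous f) (f0 : forall x, 0 <= f x).
Hypothesis fi : mu.-integrable setT (EFin \o f).
Variables C S : R -> R.
Hypothesis CE : forall l : R, 0 < l -> \int[mu]_y (f y * cos (l * y)) = C l.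
Hypothesis SE : forall l : R, 0 < l -> \int[mu]_y (f y * sin (l * y)) = S l.
Hypotheses (Ci : mu.-integrable pos (EFin \o C)) (Si : mu.-integrable pos (EFin \o S)).

Let mf : measurable_fun setT f. Proof. exact: continuous_measurable_fun. Qed.

Definition inverse_transform (x : R) : R :=
  \int[mu]_(l in pos) (cos (l * x) * C l + sin (l * x) * S l).

Let eps (n : nat) : R := n.+1%:R^-1.
Let eps_gt0 n : 0 < eps n. Proof. by rewrite invr_gt0. Qed.

(** The Poisson average of [f] around [x] at scale [eps n]. *)
Let smoothing (x : R) n := \int[mu]_u (f (- eps n * u + x) * cauchy u).

(** On the Fourier side the average is a damped inversion integral. *)
Let smoothing_fourier x n : smoothing x n =
  \int[mu]_(l in pos) (expR (- eps n * l) * (cos (l * x) * C l + sin (l * x) * S l)).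
Proof.
have e0 := eps_gt0 n; set e := eps n.
pose g y := f y * (e / (e ^+ 2 + (y - x) ^+ 2)).
have ge y : 0 < e ^+ 2 + (y - x) ^+ 2.
  by rewrite ltr_wpDr ?sqr_ge0 ?exprn_gt0.
have mg : measurable_fun setT (fun y : R => e / (e ^+ 2 + (y - x) ^+ 2)).
  apply: continuous_measurable_fun => y; apply: cvgMr; apply: cvgV.
    by rewrite gt_eqF.
  apply: cvgD; first exact: cvg_cst.
  apply: (@continuous_comp _ _ _ (fun y => y - x) (fun y => y ^+ 2)).
    by apply: cvgB; [exact: cvg_id|exact: cvg_cst].
  exact: exprn_continuous.
have gi : mu.-integrable setT (EFin \o g).
  apply: (@ler_integrable _ _ _ mu setT _ (fun y => f y * e^-1)) => //.
  - exact: measurable_funM.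
  - move=> y _; rewrite normrM ger0_norm // ler_wpM2l // ger0_norm; last first.
      by rewrite divr_ge0 ?ltW.
    rewrite ler_pdivrMr // mulrDr expr2 mulrA mulVf ?gt_eqF // mul1r.
    by rewrite lerDl mulr_ge0 ?sqr_ge0 // invr_ge0 ltW.
  - under eq_fun do rewrite mulrC.
    exact: RintegrableZl.
have en0 : - e != 0 by rewrite oppr_eq0 gt_eqF.
transitivity (\int[mu]_y g y).
  rewrite (Rintegral_affine x en0 gi) normrN gtr0_norm // -RintegralZl //; last first.
    exact: integrable_affine.
  apply: eq_Rintegral => u _; rewrite /g /oneDsqr addrK mulrCA; congr (_ * _).
  have u0 : 1 + u ^+ 2 != 0 by rewrite gt_eqF // ltr_wpDr ?sqr_ge0.
  have -> : e ^+ 2 + (- e * u) ^+ 2 = e ^+ 2 * (1 + u ^+ 2) by ring.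
  by field; rewrite u0 gt_eqF.
transitivity (\int[mu]_y (f y *
    \int[mu]_(l in pos) (expR (- e * l) * cos (- (l * x) + l * y)))).
  apply: eq_Rintegral => y _; congr (_ * _).
  rewrite -(Laplace_cos (y - x) e0); apply: eq_Rintegral => l _.
  by congr (_ * cos _); ring.
rewrite Fubini_phase //; first last.
- by apply: measurable_funN; exact: measurable_funM.
- exact: integrable_expRN.
apply: eq_Rintegral => l; rewrite inE /= in_itv /= andbT => l0.
by rewrite CE // SE // cosN sinN (mulNr (sin _)) opprK.
Qed.

Let smoothing_cvg x : smoothing x n @[n --> \oo] --> inverse_transform x.
Proof.
under eq_fun do rewrite smoothing_fourier.
have /measurable_EFinP mC := measurable_int _ Ci.
have /measurable_EFinP mS := measurable_int _ Si.
have mk : measurable_fun pos (fun l => cos (l * x) * C l + sin (l * x) * S l).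
  have ml : measurable_fun pos (fun l : R => l * x).
    by apply: measurable_funTS; exact: measurable_funM.
  by apply: measurable_funD; apply: measurable_funM => //;
    apply: measurableT_comp => //; case: (@measurable_cosin R).
apply: (@Rdominated_cvg _ _ _ mu pos _ _ (fun l => `|C l| + `|S l|)) => //.
- move=> n; apply: measurable_funM => //; apply: measurable_funTS.
  apply: (measurableT_comp (@measurable_expR R)); exact: measurable_funM.
- move=> l _; rewrite -[X in _ --> X]mul1r; apply: cvgMl.
  rewrite -(expR0 R); apply: (continuous_cvg _ (@continuous_expR R 0)).
  under eq_fun do rewrite mulNr; rewrite -oppr0; apply: cvgN.
  rewrite -(mul0r l); apply: cvgMl; exact: cvg_harmonic.
- by apply: RintegrableD => //; exact: integrable_norm.
- move=> n l /=; rewrite in_itv /= andbT => l0.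
  rewrite normrM ger0_norm ?expR_ge0 //.
  apply: (@le_trans _ _ (`|cos (l * x) * C l + sin (l * x) * S l|)).
    apply: ler_piMl => //; rewrite -(expR0 R) ler_expR mulNr oppr_le0.
    by rewrite mulr_ge0 ?ltW // eps_gt0.
  apply: (le_trans (ler_normD _ _)); apply: lerD; rewrite normrM ler_piMl //.
    by rewrite ler_norml cos_geN1 cos_le1.
  by rewrite ler_norml sin_geN1 sin_le1.
Qed.

(** The Cauchy weight has mass [pi], so averages of a bounded continuous function
    recover [pi] times its value by dominated convergence. *)
Let truncated_cvg x (M : R) (g : R -> R) : continuous g ->
  (forall y, 0 <= g y <= M) ->
  \int[mu]_u (g (- eps n * u + x) * cauchy u) @[n --> \oo] --> pi * g x.
Proof.
move=> cg gM.
have -> : pi * g x = \int[mu]_u (g x * cauchy u).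
  rewrite RintegralZl //; last exact: integrable_cauchy.
  by rewrite /Rintegral integral_cauchy mulrC.
have mc := @measurable_cauchy R.
apply: (@Rdominated_cvg _ _ _ mu setT _ _ (fun u => M * cauchy u)) => //.
- move=> n; apply: measurable_funM => //.
  apply: (measurableT_comp (continuous_measurable_fun cg)).
  exact: (measurable_affine (- eps n) x).
- move=> u _; apply: cvgMl; apply: (continuous_cvg _ (cg x)).
  rewrite -[X in _ --> X]add0r; apply: cvgD; last exact: cvg_cst.
  rewrite -(mul0r u); apply: cvgMl; rewrite -oppr0; apply: cvgN.
  exact: cvg_harmonic.
- by apply: RintegrableZl => //; exact: integrable_cauchy.
- move=> n u _; have /andP[g1 g2] := gM (- eps n * u + x).
  rewrite normrM ger0_norm // ger0_norm ?(ltW (cauchy_gt0 u)) //.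
  by rewrite ler_wpM2r // ltW // cauchy_gt0.
Qed.

Let smoothing_integrable x n :
  mu.-integrable setT (EFin \o (fun u => f (- eps n * u + x) * cauchy u)).
Proof.
have en0 : - eps n != 0 by rewrite oppr_eq0 gt_eqF.
have fai := integrable_affine x en0 fi.
apply: ler_integrable fai => //.
  apply: measurable_funM; last first.
    exact: measurable_cauchy.
  exact: (measurableT_comp mf (measurable_affine (- eps n) x)).
move=> u _; rewrite normrM ger0_norm // ger0_norm ?(ltW (cauchy_gt0 u)) //.
by rewrite ler_piMr // oneDsqrV_le1.
Qed.

(** A density is not known to be bounded beforehand.  Its truncation at height
    [f x] is, and has the same value at [x], which gives an upper bound for
    [f x] and hence boundedness. *)
Let inverse_transform_ge x : pi * f x <= inverse_transform x.
Proof.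
pose g y := Num.min (f y) (f x).
have gb y : 0 <= g y <= f x by rewrite /g le_min !f0 ge_min lexx orbT.
have cg : continuous g.
  move=> y; rewrite /g /=.
  have -> : (fun y => Num.min (f y) (f x)) = f \min (cst (f x)) by [].
  by apply: continuous_min; [exact: cf|exact: cvg_cst].
have := @truncated_cvg x _ g cg gb; rewrite {2}/g minxx => h.
apply: (ler_cvg_to h (@smoothing_cvg x)); apply: nearW => n.
apply: le_Rintegral => //.
- apply: ler_integrable (smoothing_integrable x n) => //.
    apply: measurable_funM; last first.
      exact: measurable_cauchy.
    apply: (measurableT_comp (continuous_measurable_fun cg)).
    exact: (measurable_affine (- eps n) x).
  move=> u _; rewrite normrM ger0_norm; last by case/andP: (gb (- eps n * u + x)).
  rewrite ger0_norm ?(ltW (cauchy_gt0 u)) //.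
  by rewrite ler_wpM2r ?(ltW (cauchy_gt0 u)) // /g ge_min lexx.
- by move=> u _; rewrite ler_wpM2r ?(ltW (cauchy_gt0 u)) // /g ge_min lexx.
Qed.

Lemma Fourier_inversion x : pi * f x = inverse_transform x.
Proof.
pose B := pi^-1 * \int[mu]_(l in pos) (`|C l| + `|S l|).
have fB y : 0 <= f y <= B.
  rewrite f0 /= ler_pdivlMl ?pi_gt0 //; apply: (le_trans (inverse_transform_ge y)).
  have ki : mu.-integrable pos (EFin \o (fun l => cos (l * y) * C l + sin (l * y) * S l)).
    have ml : measurable_fun pos (fun l : R => l * y).
      by apply: measurable_funTS; exact: measurable_funM.
    rewrite (_ : (fun l => _) = (fun l => C l * cos (l * y) + S l * sin (l * y))).
      2: by apply/funext => l; rewrite mulrC (mulrC (sin _)).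
    apply: RintegrableD => //; first exact: integrable_mul_cos.
    exact: integrable_mul_sin.
  have CSi : mu.-integrable pos (EFin \o (fun l => `|C l| + `|S l|)).
    by apply: RintegrableD => //; exact: integrable_norm.
  apply: le_Rintegral => // l _.
  apply: (le_trans (ler_norm _)); apply: (le_trans (ler_normD _ _)).
  apply: lerD; rewrite normrM ler_piMl //.
    by rewrite ler_norml cos_geN1 cos_le1.
  by rewrite ler_norml sin_geN1 sin_le1.
exact: (cvg_unique (@Rhausdorff R) (@truncated_cvg x _ f cf fB) (@smoothing_cvg x)).
Qed.

End FourierInversion.

(** * Stretched exponentials *)

Section StretchedExponential.
Context {R : realType}.
Notation mu := (@lebesgue_measure R).
Notation pos := (`]0, +oo[%classic : set R).
Implicit Types (A B x l v r : R).

Lemma powR_cvgy r : 0 < r -> l `^ r @[l --> +oo] --> +oo.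
Proof.
move=> r0; apply/cvgryPge => A; near=> l.
have M0 : 0 <= Num.max A 0 by rewrite le_max lexx orbT.
apply: (@le_trans _ _ (Num.max A 0)); first by rewrite le_max lexx.
rewrite -[leLHS](powRr1 M0) -(mulVf (lt0r_neq0 r0)) powRrM.
apply: ge0_ler_powR; rewrite ?nnegrE ?powR_ge0 ?(ltW r0) //.
Unshelve. all: by end_near. Qed.

(** The case [r = 1] is [v <= exp v], applied to [A v / r] and raised to the
    power [r]. *)
Lemma powR_le_expR A r v : 0 < A -> 0 < r -> 0 <= v ->
  v `^ r <= (r / A) `^ r * expR (A * v).
Proof.
move=> A0 r0 v0; have Ar : 0 < A / r by rewrite divr_gt0.
have -> : expR (A * v) = expR (A / r * v) `^ r.
  by rewrite -expRM; congr expR; field; rewrite gt_eqF.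
have rA : 0 <= r / A by rewrite divr_ge0 ?ltW.
have h : v <= r / A * expR (A / r * v).
  have {1}-> : v = r / A * (A / r * v) by field; rewrite !gt_eqF.
  apply: ler_wpM2l => //.
  by apply: le_trans (expR_ge1Dx _); rewrite lerDr.
rewrite -powRM ?expR_ge0 //.
by apply: ge0_ler_powR; rewrite ?nnegrE ?(ltW r0) // mulr_ge0 ?expR_ge0.
Qed.

Variable alpha : R.
Hypothesis alpha0 : 0 < alpha.

Definition stretched A l : R := expR (- A * l `^ alpha).

Lemma stretched_cvgy A : 0 < A -> stretched A l @[l --> +oo] --> 0.
Proof.
by move=> A0; apply: (cvg_comp _ _ _ (cvg_expRN A0)); exact: powR_cvgy.
Qed.

Lemma stretched_cvg0 A : stretched A l @[l --> 0^'+] --> (1 : R).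
Proof.
rewrite -(expR0 R); apply: (continuous_cvg _ (@continuous_expR R 0)).
by rewrite -[X in _ --> X](mulr0 (- A)); apply: cvgMr; exact: powR_cvg0.
Qed.

Lemma is_derive_stretched A l : 0 < l ->
  is_derive l 1 (stretched A) (stretched A l * (- A * (alpha * l `^ (alpha - 1)))).
Proof.
move=> l0; exact: is_derive_exp (is_derive_scale (- A) (is_derive1_powR alpha l0)).
Qed.

Lemma measurable_stretched A : measurable_fun [set: R] (stretched A).
Proof.
apply: (measurableT_comp (@measurable_expR R)).
by apply: measurable_funM => //; exact: measurable_powR.
Qed.

Lemma stretched_ge0 A l : 0 <= stretched A l. Proof. exact: expR_ge0. Qed.

Lemma integrable_stretched A : 0 < A -> mu.-integrable pos (EFin \o stretched A).
Proof.
move=> A0.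
(* Compare with the Cauchy weight: [l ^ 2] is the power [2 / alpha] of
   [l `^ alpha], and [powR_le_expR] bounds it. *)
pose K := 1 + (2 / alpha / A) `^ (2 / alpha).
apply: (@ler_integrable _ _ _ mu pos _ (fun l => K * (oneDsqr l)^-1)) => //.
- by apply: measurable_funTS; exact: measurable_stretched.
- move=> l /=; rewrite in_itv /= andbT => l0.
  rewrite ger0_norm ?stretched_ge0 // ler_pdivlMr; last first.
    by rewrite (lt_le_trans ltr01 (oneDsqr_ge1 l)).
  have E0 := expR_gt0 (A * l `^ alpha).
  rewrite /stretched mulNr expRN mulrC ler_pdivrMr // /oneDsqr mulrDl mul1r.
  apply: lerD; first by rewrite -expR0 ler_expR mulr_ge0 ?powR_ge0 ?ltW.
  have -> : l ^+ 2 = (l `^ alpha) `^ (2 / alpha).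
    rewrite -powRrM -powR_mulrn ?(ltW l0) //; congr powR.
    by field; rewrite gt_eqF.
  by apply: powR_le_expR; rewrite ?divr_gt0 ?powR_ge0.
- apply: (@integrableS _ _ _ mu setT pos) => //.
  by apply: RintegrableZl => //; exact: integrable_cauchy.
Qed.

(** The singular power is, up to a constant, the derivative of the exponent, so
    the antiderivative is explicit and bounded. *)
Lemma integrable_powR_stretched A : 0 < A ->
  mu.-integrable pos (EFin \o (fun l => l `^ (alpha - 1) * stretched A l)).
Proof.
move=> A0; pose c := - (A * alpha)^-1.
have dF (l : R) : 0 < l -> is_derive l 1 (fun l => c * stretched A l)
    (l `^ (alpha - 1) * stretched A l).
  move=> l0; apply: is_derive_eq (is_derive_scale c (is_derive_stretched A l0)) _.
  by rewrite /c; field; rewrite !gt_eqF.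
have cF (l : R) : 0 < l -> {for l, continuous (fun l => l `^ (alpha - 1) * stretched A l)}.
  move=> l0; exact: is_derive_continuous
    (is_derive_mul (is_derive1_powR (alpha - 1) l0) (is_derive_stretched A l0)).
have F0 : c * stretched A l @[l --> 0^'+] --> c * 1.
  by apply: cvgMr; exact: stretched_cvg0.
have Fy : c * stretched A l @[l --> +oo] --> c * 0.
  by apply: cvgMr; exact: stretched_cvgy.
have p0 (l : R) : 0 < l -> 0 <= l `^ (alpha - 1) * stretched A l.
  by move=> _; rewrite mulr_ge0 ?powR_ge0 ?stretched_ge0.
exact: (ge0_halfline_integrable dF cF p0 F0 Fy).
Qed.

Lemma integrable_powR2_stretched A : 0 < A ->
  mu.-integrable pos
    (EFin \o (fun l => l `^ (alpha - 1) * (l `^ alpha * stretched A l))).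
Proof.
move=> A0; have A20 : 0 < A / 2 by rewrite divr_gt0.
have h := @RintegrableZl _ _ _ mu pos _ (A / 2)^-1 (measurable_itv _)
  (integrable_powR_stretched A20).
apply: ler_integrable h => //.
  apply: measurable_funTS; apply: measurable_funM; first exact: measurable_powR.
  by apply: measurable_funM; [exact: measurable_powR|exact: measurable_stretched].
move=> l _; have p0 := powR_ge0 l.
rewrite ger0_norm ?mulr_ge0 ?stretched_ge0 // [leRHS]mulrCA; apply: ler_wpM2l => //.
(* Half of the exponential decay absorbs the factor [l `^ alpha]. *)
have -> : stretched A l = expR (- (A / 2 * l `^ alpha)) * stretched (A / 2) l.
  by rewrite /stretched -expRD; congr expR; field.
rewrite mulrA ler_wpM2r ?stretched_ge0 // expRN ler_pdivrMr ?expR_gt0 //.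
have := powR_le_expR A20 ltr01 (p0 alpha).
by rewrite !powRr1 ?div1r // invr_ge0 ltW.
Qed.

End StretchedExponential.

(** * Stable laws and their convolution *)

Section StableLaws.
Context {R : realType}.
Notation mu := (@lebesgue_measure R).
Notation pos := (`]0, +oo[%classic : set R).
Variable alpha : R.
Hypothesis alpha0 : 0 < alpha.
Implicit Types (a b A B x l t s : R) (f : R -> R).

(** Densities whose characteristic function at [l > 0] is
    [exp(- (A - i B) l ^ alpha)], split into real and imaginary parts. *)
Definition stable_law A B f : Prop :=
  [/\ continuous f, forall x, 0 <= f x, (\int[mu]_x (f x)%:E = 1)%E,
      forall l, 0 < l ->
        \int[mu]_y (f y * cos (l * y)) = stretched alpha A l * cos (B * l `^ alpha) &
      forall l, 0 < l ->
        \int[mu]_y (f y * sin (l * y)) = stretched alpha A l * sin (B * l `^ alpha)].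

Definition phase B x l : R := B * l `^ alpha - l * x.

Lemma measurable_phase B x : measurable_fun [set: R] (phase B x).
Proof.
apply: measurable_funB; last exact: measurable_funM.
by apply: measurable_funM => //; exact: measurable_powR.
Qed.

Lemma density_integrable f : continuous f -> (forall x, 0 <= f x) ->
  (\int[mu]_x (f x)%:E = 1)%E -> mu.-integrable setT (EFin \o f).
Proof.
move=> cf f0 f1; apply/integrableP; split.
  by apply/measurable_EFinP; exact: continuous_measurable_fun.
rewrite (_ : integral _ _ _ = 1%E) ?ltry // -f1.
by apply: eq_integral => x _; rewrite /= ger0_norm.
Qed.

Lemma stable_inversion A B f x : 0 < A -> stable_law A B f ->
  f x = \int[mu]_(l in pos) (pi^-1 * stretched alpha A l * cos (phase B x l)).
Proof.
move=> A0 [cf f0 f1 fC fS]; have fi := density_integrable cf f0 f1.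
have iE := integrable_stretched alpha0 A0.
have mB : measurable_fun pos (fun l : R => B * l `^ alpha).
  by apply: measurable_funM => //; apply: measurable_funTS; exact: measurable_powR.
have H := Fourier_inversion cf f0 fi fC fS
  (integrable_mul_cos (measurable_itv _) iE mB)
  (integrable_mul_sin (measurable_itv _) iE mB) x.
have pi0 : pi != 0 :> R by rewrite gt_eqF // pi_gt0.
rewrite -[LHS](mulKf pi0) H /inverse_transform -RintegralZl //.
- apply: eq_Rintegral => l _; rewrite /phase cosB; ring.
- rewrite (_ : (fun l => _) = (fun l => stretched alpha A l * cos (phase B x l))).
    2: by apply/funext => l; rewrite /phase cosB; ring.
  by apply: integrable_mul_cos => //; apply: measurable_funTS; exact: measurable_phase.
Qed.

Lemma stretchedD A1 A2 l :
  stretched alpha A1 l * stretched alpha A2 l = stretched alpha (A1 + A2) l.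
Proof. by rewrite /stretched -expRD; congr expR; ring. Qed.

(** Insert the inversion formula for [f1]: the integral over [y] then yields the
    characteristic function of [f2], and the two multiply. *)
Lemma stable_convolution A1 B1 f1 A2 B2 f2 f x : 0 < A1 -> 0 < A2 ->
  stable_law A1 B1 f1 -> stable_law A2 B2 f2 -> stable_law (A1 + A2) (B1 + B2) f ->
  \int[mu]_y (f2 y * f1 (x - y)) = f x.
Proof.
move=> A10 A20 F1 F2 F; have [cf f0 fi1 fC fS] := F2.
rewrite (stable_inversion x (addr_gt0 A10 A20) F).
transitivity (\int[mu]_y (f2 y * \int[mu]_(l in pos)
    (pi^-1 * stretched alpha A1 l * cos (phase B1 x l + l * y)))).
  apply: eq_Rintegral => y _; rewrite (stable_inversion (x - y) A10 F1).
  by congr (_ * _); apply: eq_Rintegral => l _; congr (_ * cos _); rewrite /phase; ring.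
rewrite Fubini_phase //.
- apply: eq_Rintegral => l; rewrite inE /= in_itv /= andbT => l0.
  rewrite fC // fS // -stretchedD.
  have -> : phase (B1 + B2) x l = phase B1 x l + B2 * l `^ alpha.
    by rewrite /phase; ring.
  by rewrite cosD; ring.
- exact: density_integrable.
- by apply: RintegrableZl => //; exact: integrable_stretched.
- exact: measurable_phase.
Qed.

(** [alpha * t * decay_integrand] is the derivative in [l] of the stretched
    exponential times the sine of the phase, the contribution of the term
    [- l * x] of the phase being left out. *)
Definition decay_integrand a b x t l : R :=
  l `^ (alpha - 1) * (stretched alpha (t * a) l *
    (b * cos (phase (t * b) x l) - a * sin (phase (t * b) x l))).

Definition decay a b x t : R := \int[mu]_(l in pos) decay_integrand a b x t l.

Lemma decay_integrable a b x t : 0 < a -> 0 < t ->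
  mu.-integrable pos (EFin \o decay_integrand a b x t).
Proof.
move=> a0 t0; have ta0 : 0 < t * a by rewrite mulr_gt0.
have mph := @measurable_funTS _ _ _ _ pos _ (measurable_phase (t * b) x).
have h := integrable_powR_stretched alpha0 ta0.
rewrite (_ : decay_integrand a b x t = (fun l =>
    b * (l `^ (alpha - 1) * stretched alpha (t * a) l * cos (phase (t * b) x l)) -
    a * (l `^ (alpha - 1) * stretched alpha (t * a) l * sin (phase (t * b) x l)))).
  2: by apply/funext => l; rewrite /decay_integrand; ring.
apply: RintegrableB => //; apply: RintegrableZl => //.
  exact: integrable_mul_cos.
exact: integrable_mul_sin.
Qed.

Lemma is_derive_phase B x l : 0 < l ->
  is_derive l 1 (phase B x) (B * (alpha * l `^ (alpha - 1)) - x).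
Proof.
move=> l0; rewrite /phase.
apply: is_derive_eq (is_derive_sub (is_derive_scale B (is_derive1_powR alpha l0))
  (is_derive_mul (is_derive_id l 1) (is_derive_cst x l 1))) _.
by rewrite mulr0 add0r mulr1.
Qed.

Lemma phase_cvg0 B x : phase B x l @[l --> 0^'+] --> (0 : R).
Proof.
rewrite -[X in _ --> X](subrr (0 : R)); apply: cvgB.
  by rewrite -[X in _ --> X](mulr0 B); apply: cvgMr; exact: powR_cvg0.
rewrite -[X in _ --> X](mul0r x); apply: cvgMl.
by apply: cvg_at_right_filter; exact: cvg_id.
Qed.

(** Integration by parts in the inversion formula. *)
Lemma stable_decay a b f t x : 0 < a -> 0 < t -> stable_law (t * a) (t * b) f ->
  x * f x = pi^-1 * alpha * t * decay a b x t.
Proof.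
move=> a0 t0 F; have ta0 : 0 < t * a by rewrite mulr_gt0.
have pi0 : pi != 0 :> R by rewrite gt_eqF // pi_gt0.
rewrite (stable_inversion x ta0 F).
pose k l := stretched alpha (t * a) l * cos (phase (t * b) x l).
have mph := @measurable_funTS _ _ _ _ pos _ (measurable_phase (t * b) x).
have ki : mu.-integrable pos (EFin \o k).
  by apply: integrable_mul_cos => //; exact: integrable_stretched.
have di := decay_integrable b x a0 t0.
have -> : \int[mu]_(l in pos) (pi^-1 * stretched alpha (t * a) l *
    cos (phase (t * b) x l)) = pi^-1 * \int[mu]_(l in pos) k l.
  by rewrite -RintegralZl //; apply: eq_Rintegral => l _; rewrite /k; ring.
suff H : \int[mu]_(l in pos) (alpha * t * decay_integrand a b x t l - x * k l) = 0.
  move: H; rewrite RintegralB ?RintegralZl //; last 2 first.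
  - exact: RintegrableZl.
  - exact: RintegrableZl.
  move=> /eqP; rewrite subr_eq0 => /eqP H.
  by rewrite mulrCA -H /decay; ring.
(* The boundary terms of the integration by parts: the sine vanishes at 0 and
   the amplitude at infinity. *)
pose F0 l := stretched alpha (t * a) l * sin (phase (t * b) x l).
pose dF0 l := alpha * t * decay_integrand a b x t l - x * k l.
have dF (l : R) : 0 < l -> is_derive l 1 F0 (dF0 l).
  move=> l0; have [_ ds] := is_derive_cosin (is_derive_phase (t * b) x l0).
  apply: is_derive_eq (is_derive_mul (is_derive_stretched alpha (t * a) l0) ds) _.
  by rewrite /dF0 /decay_integrand /k; ring.
have cF (l : R) : 0 < l -> {for l, continuous dF0}.
  move=> l0; have [dc ds] := is_derive_cosin (is_derive_phase (t * b) x l0).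
  have dE := is_derive_stretched alpha (t * a) l0.
  have dp := is_derive1_powR (alpha - 1) l0.
  have dD := is_derive_mul dp (is_derive_mul dE
    (is_derive_sub (is_derive_scale b dc) (is_derive_scale a ds))).
  exact: is_derive_continuous (is_derive_sub (is_derive_scale (alpha * t) dD)
    (is_derive_scale x (is_derive_mul dE dc))).
have iF : mu.-integrable pos (EFin \o dF0).
  by apply: RintegrableB => //; exact: RintegrableZl.
have lim0 : F0 l @[l --> 0^'+] --> (0 : R).
  rewrite -[X in _ --> X](mulr0 (1 : R)); apply: cvgM; first exact: stretched_cvg0.
  rewrite -[X in _ --> X](sin0 R); apply: (continuous_cvg _ (@continuous_sin R 0)).
  exact: phase_cvg0.
have limy : F0 l @[l --> +oo] --> (0 : R).
  have h1 := stretched_cvgy alpha0 ta0.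
  have h2 : - stretched alpha (t * a) l @[l --> +oo] --> (0 : R).
    by rewrite -oppr0; exact: cvgN.
  apply: (squeeze_cvgr _ h2 h1); apply: nearW => l.
  rewrite -ler_norml normrM ger0_norm ?stretched_ge0 // ler_piMr ?stretched_ge0 //.
  by rewrite ler_norml sin_geN1 sin_le1.
by rewrite (FTC_halfline dF cF iF lim0 limy) subrr.
Qed.

Lemma is_derive_decay_integrand a b x l t :
  is_derive t 1 (fun t => decay_integrand a b x t l)
    (l `^ (alpha - 1) * (l `^ alpha * stretched alpha (t * a) l *
      ((a ^+ 2 - b ^+ 2) * sin (phase (t * b) x l)
       - 2 * a * b * cos (phase (t * b) x l)))).
Proof.
have dlin c : is_derive t 1 (fun t => c * t) c by exact: is_derive_linear.
have dph : is_derive t 1 (fun t => phase (t * b) x l) (b * l `^ alpha).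
  rewrite /phase; under eq_fun do rewrite -mulrA mulrC.
  apply: is_derive_eq (is_derive_sub (dlin (b * l `^ alpha)) (is_derive_cst (l * x) t 1)) _.
  by rewrite subr0.
have dE : is_derive t 1 (fun t => stretched alpha (t * a) l)
    (stretched alpha (t * a) l * - (a * l `^ alpha)).
  rewrite /stretched (_ : (fun t => _) = (fun t => expR (- (a * l `^ alpha) * t))).
    2: by apply/funext => r; congr expR; ring.
  apply: is_derive_eq (is_derive_exp (dlin (- (a * l `^ alpha)))) _.
  by congr (expR _ * _); ring.
have [dc ds] := is_derive_cosin dph.
apply: is_derive_eq (is_derive_scale (l `^ (alpha - 1)) (is_derive_mul dE
    (is_derive_sub (is_derive_scale b dc) (is_derive_scale a ds)))) _.
ring.
Qed.

(** Differentiating the integrand in [t] costs a factor [l `^ alpha], which the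
    stretched exponential absorbs; [x] only enters through sines and cosines,
    so the constant does not depend on it. *)
Lemma decay_Lipschitz a b t0 : 0 < a -> 0 < t0 -> exists2 K, 0 <= K &
  forall x t s, t0 <= t -> t <= s -> `|decay a b x s - decay a b x t| <= K * (s - t).
Proof.
move=> a0 t00; have ta0 : 0 < t0 * a by rewrite mulr_gt0.
pose M : R := `|a ^+ 2 - b ^+ 2| + `|2 * a * b|.
pose g l := l `^ (alpha - 1) * (l `^ alpha * stretched alpha (t0 * a) l).
have gi : mu.-integrable pos (EFin \o g) by exact: integrable_powR2_stretched.
have M0 : 0 <= M by rewrite addr_ge0.
have g0 l : 0 <= g l by rewrite /g !mulr_ge0 ?powR_ge0 ?stretched_ge0.
exists (M * \int[mu]_(l in pos) g l).
  by rewrite mulr_ge0 // Rintegral_ge0.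
move=> x t s t0t ts.
have t_gt0 := lt_le_trans t00 t0t; have s_gt0 := lt_le_trans t_gt0 ts.
have dit := decay_integrable b x a0 t_gt0.
have dis := decay_integrable b x a0 s_gt0.
rewrite /decay -RintegralB // mulrC mulrA -RintegralZl //.
apply: (le_trans (le_normr_Rintegral _ _)) => //; first exact: RintegrableB.
apply: le_Rintegral => //.
- by apply: integrable_norm => //; exact: RintegrableB.
- exact: RintegrableZl.
move=> l _; pose D (r : R) := l `^ (alpha - 1) * (l `^ alpha * stretched alpha (r * a) l *
  ((a ^+ 2 - b ^+ 2) * sin (phase (r * b) x l)
   - 2 * a * b * cos (phase (r * b) x l))).
have dD (r : R) : is_derive r 1 (fun t => decay_integrand a b x t l) (D r).
  exact: is_derive_decay_integrand.
have [c /andP[tc _] ->] : exists2 c, t <= c <= s &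
    decay_integrand a b x s l - decay_integrand a b x t l = D c * (s - t).
  have [|c + E] := @MVT_segment R (fun t => decay_integrand a b x t l) D _ _ ts (fun r _ => dD r).
    by apply: derivable_within_continuous => r _; case: (dD r).
  by rewrite in_itv /=; exists c.
rewrite normrM (ger0_norm (_ : 0 <= s - t)) ?subr_ge0 // [leLHS]mulrC -(mulrA (s - t)).
rewrite ler_wpM2l ?subr_ge0 // /D /g !normrM !(ger0_norm (powR_ge0 _ _)).
rewrite (ger0_norm (stretched_ge0 _ _ _)) [leRHS]mulrCA.
apply: ler_wpM2l; first exact: powR_ge0.
rewrite [leRHS]mulrC; apply: ler_pM; rewrite ?mulr_ge0 ?powR_ge0 ?stretched_ge0 //.
  apply: ler_wpM2l; first exact: powR_ge0.
  rewrite ler_expR ler_wpM2r ?powR_ge0 // lerN2 ler_pM2r //.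
  exact: le_trans tc.
apply: (le_trans (ler_normB _ _)); apply: lerD; rewrite normrM ler_piMr //.
  by rewrite ler_norml sin_geN1 sin_le1.
by rewrite ler_norml cos_geN1 cos_le1.
Qed.

End StableLaws.

(** * The stable density and its dilations *)

Section StableDensity.
Context {R : realType}.
Notation mu := (@lebesgue_measure R).
Notation pos := (`]0, +oo[%classic : set R).
Variables alpha beta : R.
Hypotheses (halpha : 0 < alpha < 2) (hbeta : -1 < beta < 1).

(** This keeps the argument of the symbol away from [pi / 2], so that its real
    part is positive. *)
Lemma stable_rho_lt1 : -1 < stable_rho alpha beta < 1.
Proof.
move: halpha hbeta => /andP[a0 a2] /andP[b1 b2]; rewrite /stable_rho.
case: ifPn => [a1|]; first by apply/andP; split; nra.
rewrite -leNgt => a1; case: ifPn => [//|_].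
by apply/andP; split; nra.
Qed.

Let theta : R := pi / 2 * stable_rho alpha beta.

Lemma cos_stable_gt0 : 0 < cos theta.
Proof.
have /andP[r1 r2] := stable_rho_lt1; have p0 := pi_gt0 R.
by apply: cos_gt0_pihalf; rewrite /theta; apply/andP; split; nra.
Qed.

Lemma stable_density_law f : stable_density alpha beta f ->
  stable_law alpha (cos theta) (sin theta) f.
Proof.
move=> [cf f0 f1 fF].
have key l : 0 < l ->
    \int[mu]_y (f y * cos (l * y)) =
      stretched alpha (cos theta) l * cos (sin theta * l `^ alpha) /\
    \int[mu]_y (f y * sin (l * y)) =
      stretched alpha (cos theta) l * sin (sin theta * l `^ alpha).
  move=> l0; have := fF l; rewrite /cintegral /stable_symbol /cexp.
  rewrite gtr0_sg // mulr1 -/theta gtr0_norm //= => -[hc hs].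
  rewrite expR0 cosN sinN in hc hs; split.
    transitivity (\int[mu]_x (1 * cos (l * x) * f x - 1 * sin (l * x) * 0)).
      by apply: eq_Rintegral => y _; ring.
    by rewrite hc /stretched; congr (expR _ * cos _); ring.
  transitivity (\int[mu]_x (1 * cos (l * x) * 0 + 1 * sin (l * x) * f x)).
    by apply: eq_Rintegral => y _; ring.
  by rewrite hs /stretched; congr (expR _ * sin _); ring.
by split => // l /key[].
Qed.

End StableDensity.

Section Dilation.
Context {R : realType}.
Notation mu := (@lebesgue_measure R).
Notation pos := (`]0, +oo[%classic : set R).
Variable alpha : R.
Hypothesis alpha0 : 0 < alpha.
Implicit Types (f : R -> R) (t x y : R).

Definition dilation t f x : R := t `^ (- alpha^-1) * f (x / t `^ alpha^-1).

Lemma dilationE t f x :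
  dilation t f x = t `^ (- alpha^-1) * f (t `^ (- alpha^-1) * x + 0).
Proof. by rewrite /dilation powRN addr0 mulrC (mulrC x) mulrC. Qed.

Let k_gt0 t : 0 < t -> 0 < t `^ (- alpha^-1). Proof. exact: powR_gt0. Qed.

Lemma Rintegral_dilation t f (g : R -> R) : 0 < t ->
  mu.-integrable setT (EFin \o (fun z => f z * g (z * t `^ alpha^-1))) ->
  \int[mu]_y (dilation t f y * g y) = \int[mu]_z (f z * g (z * t `^ alpha^-1)).
Proof.
move=> t0 fi; have k0 := k_gt0 t0; have kn0 : t `^ (- alpha^-1) != 0 by rewrite gt_eqF.
rewrite [RHS](Rintegral_affine 0 kn0 fi) gtr0_norm // -RintegralZl //; last first.
  exact: (integrable_affine 0 kn0 fi).
apply: eq_Rintegral => y _; rewrite dilationE -mulrA; congr (_ * (f _ * g _)).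
by rewrite addr0 mulrC mulrA -powRD ?subrr ?powRr0 ?mul1r //; apply/implyP => _; rewrite gt_eqF.
Qed.

Lemma stable_law_dilation A B f t : 0 < t -> stable_law alpha A B f ->
  stable_law alpha (t * A) (t * B) (dilation t f).
Proof.
move=> t0 [cf f0 f1 fC fS]; have k0 := k_gt0 t0.
have fi := density_integrable cf f0 f1.
have kn0 : t `^ (- alpha^-1) != 0 by rewrite gt_eqF.
have q0 : 0 < t `^ alpha^-1 by exact: powR_gt0.
have qa : (t `^ alpha^-1) `^ alpha = t.
  by rewrite -powRrM mulVf ?gt_eqF // powRr1 // ltW.
have sq C (l : R) : 0 < l -> stretched alpha C (t `^ alpha^-1 * l) = stretched alpha (t * C) l.
  by move=> l0; rewrite /stretched powRM ?ltW // qa; congr expR; ring.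
have pw (l : R) : 0 < l -> t * B * l `^ alpha = B * (t `^ alpha^-1 * l) `^ alpha.
  by move=> l0; rewrite powRM ?ltW // qa; ring.
split.
- move=> x; rewrite /dilation; apply: cvgMr.
  apply: (@continuous_comp _ _ _ (fun x => x / t `^ alpha^-1) f); last exact: cf.
  by apply: cvgMl; exact: cvg_id.
- by move=> x; rewrite mulr_ge0 // ltW.
- rewrite -f1 [RHS](ge0_integral_affine 0 kn0).
  + rewrite gtr0_norm // -ge0_integralZl //.
    * by apply: eq_integral => x _; rewrite dilationE EFinM.
    * apply/measurable_EFinP; apply: measurableT_comp (measurable_affine _ _).
      exact: continuous_measurable_fun.
    * by move=> x _; rewrite lee_fin.
    * by rewrite lee_fin ltW.
  + by apply/measurable_EFinP; exact: continuous_measurable_fun.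
  + by move=> x; rewrite lee_fin.
- move=> l l0; rewrite (@Rintegral_dilation t f (fun y => cos (l * y))) //.
    rewrite -sq // pw // -fC ?mulr_gt0 //.
    by apply: eq_Rintegral => y _; congr (_ * cos _); ring.
  apply: integrable_mul_cos => //.
  by apply: measurable_funM => //; exact: measurable_funM.
- move=> l l0; rewrite (@Rintegral_dilation t f (fun y => sin (l * y))) //.
    rewrite -sq // pw // -fS ?mulr_gt0 //.
    by apply: eq_Rintegral => y _; congr (_ * sin _); ring.
  apply: integrable_mul_sin => //.
  by apply: measurable_funM => //; exact: measurable_funM.
Qed.

End Dilation.

(** * Cumulative functions *)

Section CumulativeFunction.
Context {R : realType}.
Notation mu := (@lebesgue_measure R).
Variable f : R -> R.
Hypotheses (cf : continuous f) (f0 : forall x, 0 <= f x).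
Hypothesis f1 : (\int[mu]_x (f x)%:E = 1)%E.

Let fi : mu.-integrable setT (EFin \o f). Proof. exact: density_integrable. Qed.

Let fiE (A : set R) : measurable A -> mu.-integrable A (EFin \o f).
Proof. by move=> mA; apply: (@integrableS _ _ _ mu setT A). Qed.

Lemma is_derive_cumul (x : R) : is_derive x 1 (cumul f) (f x).
Proof.
have x1 : x < x + 1 by rewrite ltrDl.
have [d e] := @continuous_FTC1 R f -oo%O x (x + 1) x1
  (fiE (measurable_itv _)) (ltNyr _) (@cf x).
by split; [exact: d|rewrite -derive1E; exact: e].
Qed.

Lemma cumul_bounds x : 0 <= cumul f x <= 1.
Proof.
rewrite /cumul Rintegral_ge0 //= -lee_fin -f1 /Rintegral fineK; last first.
  by apply: integrable_fin_num => //; exact: fiE.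
apply: ge0_subset_integral => //.
  by apply/measurable_EFinP; exact: continuous_measurable_fun.
by move=> y _; rewrite lee_fin.
Qed.

Lemma cumul_nondecreasing : {homo cumul f : x y / x <= y}.
Proof.
move=> x y xy; rewrite /cumul /Rintegral; apply: fine_le.
- by apply: integrable_fin_num => //; exact: fiE.
- by apply: integrable_fin_num => //; exact: fiE.
apply: ge0_subset_integral => //.
- by apply/measurable_EFinP/measurable_funTS; exact: continuous_measurable_fun.
- by move=> z _; rewrite lee_fin.
- by apply: subset_itvl; rewrite bnd_simp.
Qed.

(** Monotone and bounded; the limit at minus infinity is the limit at plus
    infinity of [- cumul f (- x)]. *)
Lemma is_cvg_cumul : cvg (cumul f x @[x --> +oo]) /\ cvg (cumul f x @[x --> -oo]).
Proof.
split; apply/cvg_ex.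
  exists (sup (range (cumul f))); apply: nondecreasing_cvgr cumul_nondecreasing _.
  by exists 1 => _ [x _ <-]; case/andP: (cumul_bounds x).
pose g x := - cumul f (- x).
have gh : {homo g : x y / x <= y}.
  by move=> x y xy; rewrite /g lerN2 cumul_nondecreasing // lerN2.
have gb : has_ubound (range g).
  by exists 0 => _ [x _ <-]; rewrite /g oppr_le0; case/andP: (cumul_bounds (- x)).
exists (- sup (range g)); apply/cvgNy_compNP.
rewrite (_ : _ \o _ = (fun x => - g x)); last by apply/funext => x; rewrite /g /= opprK.
by apply: cvgN; exact: nondecreasing_cvgr.
Qed.

(** Being monotone, [cumul f] is constant between two points of the same level,
    so its derivative [f] vanishes between them and, by continuity, at both. *)
Lemma cumul_level x y : cumul f x = cumul f y -> x = y \/ (f x = 0 /\ f y = 0).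
Proof.
wlog xy : x y / x < y.
  move=> H e; have [lt|lt|->] := ltgtP x y; [exact: H| |by left].
  by have [->|[]] := H _ _ lt (esym e); [left|right].
move=> e; right.
have cst z : x <= z -> z <= y -> cumul f z = cumul f x.
  by move=> xz zy; apply/eqP; rewrite eq_le {1}e !cumul_nondecreasing.
have fz z : x < z -> z < y -> f z = 0.
  move=> xz zy; have [_ <-] := is_derive_cumul z.
  rewrite -(derive_cst (cumul f x) z (1 : R)); apply: near_eq_derive => //.
  near=> w; apply: cst.
    by apply/ltW; near: w; exact: lt_nbhsr.
  by apply/ltW; near: w; exact: lt_nbhsl.
split.
  apply: (cvg_unique (@Rhausdorff R) (cvg_at_right_filter (@cf x))).
  apply: cvg_near_cst; near=> z; apply: fz.
    by near: z; exact: nbhs_right_gt.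
  by near: z; exact: nbhs_right_lt.
apply: (cvg_unique (@Rhausdorff R) (cvg_at_left_filter (@cf y))).
apply: cvg_near_cst; near=> z; apply: fz.
  by near: z; exact: nbhs_left_gt.
by near: z; exact: nbhs_left_lt.
Unshelve. all: by end_near. Qed.

End CumulativeFunction.

Section CumulativeConvolution.
Context {R : realType}.
Notation mu := (@lebesgue_measure R).
Notation pos := (`]0, +oo[%classic : set R).
Variable alpha : R.
Hypothesis alpha0 : 0 < alpha.
Implicit Types (f : R -> R) (t x y : R).

Lemma cumul_shift f x (y : R) : mu.-integrable setT (EFin \o f) ->
  cumul f (x - y) = \int[mu]_(s in `]-oo, x]) f (s - y).
Proof.
move=> fi; pose g := f \_ `]-oo, x - y].
have gi : mu.-integrable setT (EFin \o g).
  rewrite /g -restrict_EFin.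
  apply: (@integrable_mkcond _ _ _ mu _ (EFin \o f) (measurable_itv _)).1.
  exact: (@integrableS _ _ _ mu setT).
rewrite /cumul Rintegral_mkcond (Rintegral_affine (- y) (oner_neq0 R) gi) normr1 mul1r.
rewrite [RHS]Rintegral_mkcond; apply: eq_Rintegral => s _.
by rewrite /g !patchE !mem_setE !in_itv /= mul1r lerD2r.
Qed.

Lemma cumul_dilation f t x : 0 < t -> mu.-integrable setT (EFin \o f) ->
  cumul (dilation alpha t f) x = cumul f (x * t `^ (- alpha^-1)).
Proof.
move=> t0 fi; pose k := t `^ (- alpha^-1); have k0 : 0 < k by exact: powR_gt0.
have kn0 : k != 0 by rewrite gt_eqF.
pose g := f \_ `]-oo, x * k].
have gi : mu.-integrable setT (EFin \o g).
  rewrite /g -restrict_EFin.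
  apply: (@integrable_mkcond _ _ _ mu _ (EFin \o f) (measurable_itv _)).1.
  exact: (@integrableS _ _ _ mu setT).
rewrite /cumul [RHS]Rintegral_mkcond (Rintegral_affine 0 kn0 gi) gtr0_norm //.
rewrite -RintegralZl //; last exact: (integrable_affine 0 kn0 gi).
rewrite Rintegral_mkcond; apply: eq_Rintegral => s _.
rewrite /g !patchE !mem_setE !in_itv /= addr0 (mulrC k s) ler_pM2r //.
by case: ifP => _; rewrite ?mulr0 // dilationE addr0 (mulrC s).
Qed.

Lemma stable_bounded A B f : 0 < A -> stable_law alpha A B f ->
  exists M, forall x, 0 <= f x <= M.
Proof.
move=> A0 F; have [_ f0 _ _ _] := F.
pose E l := pi^-1 * stretched alpha A l.
have Ei : mu.-integrable pos (EFin \o E).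
  by apply: RintegrableZl => //; exact: integrable_stretched.
exists (\int[mu]_(l in pos) E l) => x; rewrite f0 /= (stable_inversion alpha0 x A0 F).
have mph := @measurable_funTS _ _ _ _ pos _ (measurable_phase alpha B x).
have E0 l : 0 <= E l by rewrite mulr_ge0 ?stretched_ge0 // invr_ge0 pi_ge0.
apply: le_Rintegral => //; first exact: integrable_mul_cos.
by move=> l _; have := ler_wpM2l (E0 l) (cos_le1 (phase alpha B x l)); rewrite mulr1.
Qed.

(** Integrate [stable_convolution] up to [x]; everything is nonnegative, so
    Tonelli's theorem exchanges the integrals. *)
Lemma cumul_convolution A1 B1 f1 A2 B2 f2 f x : 0 < A1 -> 0 < A2 ->
  stable_law alpha A1 B1 f1 -> stable_law alpha A2 B2 f2 ->
  stable_law alpha (A1 + A2) (B1 + B2) f ->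
  \int[mu]_y (f2 y * cumul f1 (x - y)) = cumul f x.
Proof.
move=> A10 A20 F1 F2 F.
have [c1 p1 i1 _ _] := F1; have [c2 p2 i2 _ _] := F2; have [c p i _ _] := F.
have fi1 := density_integrable c1 p1 i1; have fi2 := density_integrable c2 p2 i2.
have fi := density_integrable c p i.
have m1 : measurable_fun setT f1 by exact: continuous_measurable_fun.
have m2 : measurable_fun setT f2 by exact: continuous_measurable_fun.
have [M fM] := stable_bounded A10 F1.
pose I : set R := `]-oo, x]%classic.
pose h (z : R * R) : R := \1_I z.1 * (f2 z.2 * f1 (z.1 - z.2)).
have mI : measurable_fun setT (\1_I : R -> R).
  by apply: measurable_indic; exact: measurable_itv.
have h0 z : 0 <= h z by rewrite /h !mulr_ge0.
have ci s : mu.-integrable setT (EFin \o (fun y => f2 y * f1 (s - y))).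
  apply: (@ler_integrable _ _ _ mu setT _ (fun y => M * f2 y)) => //.
  - apply: measurable_funM => //; apply: measurableT_comp => //.
    exact: measurable_funB.
  - move=> y _; have /andP[_ hM] := fM (s - y).
    by rewrite ger0_norm ?mulr_ge0 // mulrC ler_wpM2r.
  - exact: RintegrableZl.
have Es s : (\int[mu]_y (EFin \o h) (s, y))%E = ((f \_ I) s)%:E.
  rewrite patchE -(stable_convolution alpha0 s A10 A20 F1 F2 F).
  rewrite /h /= indicE; case: ifP => sI.
    rewrite /Rintegral fineK; last by have := integrable_fin_num measurableT (ci s).
    by apply: eq_integral => y _; rewrite mul1r.
  by apply: integral0_eq => y _; rewrite mul0r.
have Ey y : (\int[mu]_s (EFin \o h) (s, y))%E = (f2 y * cumul f1 (x - y))%:E.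
  have si : mu.-integrable I (EFin \o (fun s => f1 (s - y))).
    apply: (@integrableS _ _ _ mu setT) => //; first exact: measurable_itv.
    have := integrable_affine (- y) (oner_neq0 R) fi1.
    rewrite (_ : (fun s => f1 (1 * s + - y)) = (fun s => f1 (s - y))) //.
    by apply/funext => s; rewrite mul1r.
  rewrite cumul_shift // EFinM /Rintegral fineK; last first.
    by have := @integrable_fin_num _ _ _ mu I (measurable_itv _) _ si.
  rewrite -(@integralZl _ _ _ mu I (measurable_itv _) _ si) [RHS]integral_mkcond.
  apply: eq_integral => s _; rewrite patchE /h /= indicE.
  by case: ifP => _; rewrite ?mul0r // mul1r EFinM.
have mh : measurable_fun setT (EFin \o h).
  apply/measurable_EFinP; apply: measurable_funM.
    exact: (measurableT_comp mI measurable_fst).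
  apply: measurable_funM; first exact: measurableT_comp.
  by apply: measurableT_comp => //; exact: measurable_funB.
have tonelli := @fubini_tonelli _ _ _ _ R mu mu (EFin \o h) mh
  (fun z => (h0 z : (0 <= (h z)%:E)%E)).
rewrite [RHS]/cumul -/I [RHS]Rintegral_mkcond [LHS]/Rintegral [RHS]/Rintegral.
congr fine; transitivity (\int[mu]_y \int[mu]_s (EFin \o h) (s, y))%E.
  by apply: eq_integral => y _; rewrite Ey.
by rewrite -tonelli; apply: eq_integral => s _; rewrite Es.
Qed.

End CumulativeConvolution.

(** * Generators in the supremum norm *)

Section SupNorm.
Context {R : realType}.
Implicit Types (phi psi : R -> R).

Lemma sup_norm_ge phi x : (`|phi x|%:E <= sup_norm phi)%E.
Proof. by apply: ereal_sup_ubound; exists x. Qed.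

Lemma sup_norm_le phi (M : R) :
  (forall x, `|phi x| <= M) -> (sup_norm phi <= M%:E)%E.
Proof. by move=> h; apply: ge_ereal_sup => _ [x _ <-]; rewrite lee_fin. Qed.

Lemma is_generator_pointwise (S : R -> (R -> R) -> R -> R) phi psi x :
  is_generator S phi psi ->
  h^-1 * (S h phi x - phi x) @[h --> 0^'+] --> psi x.
Proof.
move=> [_ _ h0]; apply/subr_cvg0; apply: norm_cvg0.
apply: (fine_cvg (f := fun h => `|h^-1 * (S h phi x - phi x) - psi x|%:E)).
apply: (squeeze_cvge _ (cvg_cst 0%E) h0); apply: nearW => h.
by rewrite lee_fin normr_ge0 /= (sup_norm_ge (fun x => h^-1 * (S h phi x - phi x) - psi x)).
Qed.

(** Convergence in the supremum norm implies pointwise convergence, so the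
    image under the generator is unique. *)
Lemma generatorE (S : R -> (R -> R) -> R -> R) phi psi :
  is_generator S phi psi -> generator S phi = psi.
Proof.
move=> g; have g' : is_generator S phi (generator S phi) by apply: getPex; exists psi.
apply/funext => x.
exact: (cvg_unique (@Rhausdorff R) (@is_generator_pointwise _ _ _ x g')
  (@is_generator_pointwise _ _ _ x g)).
Qed.

End SupNorm.

(** * The generator at a profile *)

Section StableGenerator.
Context {R : realType}.
Notation mu := (@lebesgue_measure R).
Variables (alpha a b : R) (f : R -> R).
Hypotheses (alpha0 : 0 < alpha) (a0 : 0 < a) (sf : stable_law alpha a b f).
Implicit Types (x d t h tau : R).

Let cf : continuous f. Proof. by case: sf. Qed.
Let f0 x : 0 <= f x. Proof. by case: sf. Qed.
Let f1 : (\int[mu]_x (f x)%:E = 1)%E. Proof. by case: sf. Qed.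
Let fi : mu.-integrable setT (EFin \o f). Proof. exact: density_integrable. Qed.

Local Notation k t := (t `^ (- alpha^-1)).
Let k_gt0 t : 0 < t -> 0 < k t. Proof. exact: powR_gt0. Qed.

Let law t : 0 < t -> stable_law alpha (t * a) (t * b) (dilation alpha t f).
Proof. by move=> t0; exact: stable_law_dilation. Qed.

Let continuous_profile d t : continuous (fun x => cumul f ((x + d) * k t)).
Proof.
move=> x; apply: (@continuous_comp _ _ _ (fun x => (x + d) * k t) (cumul f)).
  by apply: cvgMl; apply: cvgD; [exact: cvg_id|exact: cvg_cst].
exact: is_derive_continuous (is_derive_cumul cf f0 f1 _).
Qed.

(** The profile is the cumulative function of the dilation at time [tau];
    convolving it with the dilation at time [h] adds the times. *)
Lemma stable_semigroup_profile d tau h x : 0 < tau -> 0 < h ->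
  stable_semigroup alpha f h (fun x => cumul f ((x + d) * k tau)) x =
  cumul f ((x + d) * k (tau + h)).
Proof.
move=> tau0 h0; rewrite /stable_semigroup gt_eqF //.
have th0 : 0 < tau + h by exact: addr_gt0.
pose phi y := cumul f ((y + d) * k tau).
pose g y := dilation alpha h f (x - y) * phi y.
have [ch ph ih _ _] := law h0.
have hi := density_integrable ch ph ih.
have N10 : (-1 : R) != 0 by rewrite oppr_eq0 oner_neq0.
have mphi : measurable_fun setT phi.
  by apply: continuous_measurable_fun; exact: continuous_profile.
have gi : mu.-integrable setT (EFin \o g).
  have hi' := integrable_affine x N10 hi.
  apply: ler_integrable hi' => //.
    apply: measurable_funM => //.
    apply: measurableT_comp; first exact: continuous_measurable_fun.
    exact: measurable_funB.
  move=> y _; have /andP[p0 p1] := cumul_bounds cf f0 f1 ((y + d) * k tau).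
  have -> : -1 * y + x = x - y by ring.
  have g0 : 0 <= g y by exact: mulr_ge0.
  by rewrite (ger0_norm g0) /g ler_piMr.
transitivity (\int[mu]_y g y).
  by apply: eq_Rintegral => y _; rewrite /g /dilation.
rewrite (Rintegral_affine x N10 gi) normrN1 mul1r.
have lth : stable_law alpha (tau * a + h * a) (tau * b + h * b)
    (dilation alpha (tau + h) f) by rewrite -!mulrDl; exact: law.
rewrite -(cumul_dilation _ _ th0 fi).
rewrite -(cumul_convolution alpha0 (x + d) (mulr_gt0 tau0 a0) (mulr_gt0 h0 a0)
  (law tau0) (law h0) lth).
apply: eq_Rintegral => z _; rewrite /g /phi -(cumul_dilation _ _ tau0 fi).
by congr (dilation _ _ _ _ * cumul _ _); ring.
Qed.

(** The chain rule gives [- (alpha * t)^-1 * x * dilation alpha t f x], which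
    [stable_decay] rewrites. *)
Lemma is_derive_profile x t : 0 < t ->
  is_derive t 1 (fun t => cumul f (x * k t)) (- pi^-1 * decay alpha a b x t).
Proof.
move=> t0.
apply: is_derive_eq (@is_derive1_comp R (cumul f) (fun t => x * k t) t _ _
  (is_derive_cumul cf f0 f1 _) (is_derive_scale x (is_derive1_powR _ t0))) _.
have := stable_decay alpha0 x a0 t0 (law t0).
rewrite dilationE addr0 -/(k t) (mulrC (k t) x) => H.
rewrite powRB; last by apply/implyP => _; rewrite gt_eqF.
rewrite powRr1 ?(ltW t0) // -/(k t).
move: H (pi_gt0 R); generalize (pi : R) => P H P0.
have -> : decay alpha a b x t = P / (alpha * t) * (x * (k t * f (x * k t))).
  by rewrite H; field; rewrite !gt_eqF.
by field; rewrite !gt_eqF.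
Qed.

(** Kept as an integral, in which form its variation with [tau] is controlled;
    [profile_generatorE] gives the closed form. *)
Definition profile_generator tau d x : R := - pi^-1 * decay alpha a b (x + d) tau.

Lemma profile_generatorE tau d x : 0 < tau -> profile_generator tau d x =
  - (alpha * tau)^-1 * ((x + d) * k tau * f ((x + d) * k tau)).
Proof.
move=> t0; rewrite /profile_generator.
have := stable_decay alpha0 (x + d) a0 t0 (law t0).
rewrite dilationE addr0 -/(k tau) (mulrC (k tau) (x + d)) => H.
rewrite -[(x + d) * k tau * _]mulrA H.
move: (pi_gt0 R); clear H; generalize (pi : R) => P P0.
by field; rewrite !gt_eqF.
Qed.

(** By the mean value theorem the quotient is the time derivative at some time
    between [tau] and [tau + h]. *)
Lemma difference_quotient_bound tau d : 0 < tau -> exists2 K, 0 <= K & forall h x,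
  0 < h -> `|h^-1 * (cumul f ((x + d) * k (tau + h)) - cumul f ((x + d) * k tau))
           - profile_generator tau d x| <= K * h.
Proof.
move=> t0; have [K K0 HK] := decay_Lipschitz alpha0 b a0 t0.
have p0 := pi_gt0 R.
exists (pi^-1 * K); first by rewrite mulr_ge0 // invr_ge0 ltW.
move=> h x h0; have le_th : tau <= tau + h by rewrite lerDl ltW.
pose D t := - pi^-1 * decay alpha a b (x + d) t.
have dD t : tau <= t -> is_derive t 1 (fun t => cumul f ((x + d) * k t)) (D t).
  by move=> tt; apply: is_derive_profile; exact: lt_le_trans tt.
have [c /andP[c1 c2] ->] : exists2 c, tau <= c <= tau + h &
    cumul f ((x + d) * k (tau + h)) - cumul f ((x + d) * k tau) = D c * h.
  have [||c + E] := @MVT_segment R (fun t => cumul f ((x + d) * k t)) D _ _ le_th.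
  - by move=> t /[!in_itv] /= /andP[t1 _]; apply: dD; exact: ltW.
  - apply: derivable_within_continuous => t /[!in_itv] /= /andP[t1 _].
    by case: (dD _ t1).
  by rewrite in_itv /= => ?; exists c => //; rewrite E addrAC subrr add0r.
rewrite mulrC mulfK ?gt_eqF // /profile_generator /D -mulrBr normrM normrN.
have pV : 0 <= pi^-1 :> R by rewrite invr_ge0 ltW.
rewrite (ger0_norm pV) -(mulrA _ K h); apply: ler_wpM2l => //.
apply: (le_trans (HK _ _ _ _ c1)) => //.
by rewrite ler_wpM2l // lerBlDl.
Qed.

(** All profiles have the same limit along [G], so each difference quotient
    tends to 0; a small fixed [h] then brings the generator within [e]. *)
Lemma profile_generator_cvg0 tau d (L : R) (G : set_system R) : ProperFilter G -> 0 < tau ->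
  (forall t, 0 < t -> cumul f ((x + d) * k t) @[x --> G] --> L) ->
  profile_generator tau d x @[x --> G] --> (0 : R).
Proof.
move=> PG t0 HL; have [K K0 HK] := difference_quotient_bound d t0.
apply/cvgrPdist_le => e e0; pose h := e / 2 / (K + 1).
have K1 : 0 < K + 1 by rewrite ltr_wpDl.
have h0 : 0 < h by rewrite !divr_gt0.
have Kh : K * h <= e / 2.
  by rewrite /h mulrCA ler_piMr ?divr_ge0 ?(ltW e0) // ler_pdivrMr // mul1r lerDl.
have D0 : h^-1 * (cumul f ((x + d) * k (tau + h)) - cumul f ((x + d) * k tau))
    @[x --> G] --> (0 : R).
  rewrite -[X in _ --> X](mulr0 h^-1) -(subrr L); apply: cvgMr; apply: cvgB.
    by apply: HL; exact: addr_gt0.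
  exact: HL.
move/cvgrPdist_le : D0 => /(_ (e / 2)) D0.
have e20 : 0 < e / 2 by rewrite divr_gt0.
near=> x; have D0x : `|0 - h^-1 * (cumul f ((x + d) * k (tau + h)) -
    cumul f ((x + d) * k tau))| <= e / 2 by near: x; exact: D0.
have := HK h x h0; move: D0x; rewrite !sub0r !normrN.
set Q := h^-1 * _; set P := profile_generator _ _ _ => q1 q2.
rewrite (_ : P = Q - (Q - P)); last by ring.
apply: (le_trans (ler_normB _ _)); rewrite [leRHS](splitr e).
by apply: lerD => //; exact: le_trans Kh.
Unshelve. all: by end_near. Qed.

Lemma profile_is_generator tau d : 0 < tau ->
  is_generator (stable_semigroup alpha f)
    (fun x => cumul f ((x + d) * k tau)) (profile_generator tau d).
Proof.
move=> t0; have [Fy FNy] := is_cvg_cumul cf f0 f1.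
have cy t : 0 < t ->
    cumul f ((x + d) * k t) @[x --> +oo] --> lim (cumul f x @[x --> +oo]).
  move=> tt; apply: (cvg_comp (fun x => (x + d) * k t) _ _ Fy).
  by apply: gt0_cvgMly; [exact: k_gt0|exact: cvg_addrr].
have cNy t : 0 < t ->
    cumul f ((x + d) * k t) @[x --> -oo] --> lim (cumul f x @[x --> -oo]).
  move=> tt; apply: (cvg_comp (fun x => (x + d) * k t) _ _ FNy).
  by apply: gt0_cvgMlNy; [exact: k_gt0|exact: cvg_addrr_Ny].
split.
- split; first exact: continuous_profile.
  + by apply/cvg_ex; eexists; exact: cy.
  + by apply/cvg_ex; eexists; exact: cNy.
- split.
  + rewrite (_ : profile_generator tau d = (fun x =>
        - (alpha * tau)^-1 * ((x + d) * k tau * f ((x + d) * k tau)))).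
      2: by apply/funext => x; exact: profile_generatorE.
    move=> x; apply: cvgMr.
    have ca : {for x, continuous (fun x => (x + d) * k tau)}.
      by apply: cvgMl; apply: cvgD; [exact: cvg_id|exact: cvg_cst].
    apply: cvgM; first exact: ca.
    by apply: (@continuous_comp _ _ _ (fun x => (x + d) * k tau) f) => //; exact: cf.
  + by apply/cvg_ex; exists 0; exact: (profile_generator_cvg0 _ t0 cy).
  + by apply/cvg_ex; exists 0; exact: (profile_generator_cvg0 _ t0 cNy).
have [K K0 HK] := difference_quotient_bound d t0.
have Kh0 : (K * h)%:E @[h --> 0^'+] --> (0 : \bar R).
  apply: cvg_EFin; first exact: nearW.
  rewrite -[X in _ --> X](mulr0 K); apply: cvgMr.
  by apply: cvg_at_right_filter; exact: cvg_id.
apply: (squeeze_cvge _ (cvg_cst 0%E) Kh0); near=> h.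
have h0 : 0 < h by near: h; exact: nbhs_right_gt.
apply/andP; split.
  set g := (X in sup_norm X).
  by apply: le_trans (sup_norm_ge g 0); rewrite lee_fin.
apply: sup_norm_le => x; rewrite stable_semigroup_profile //.
exact: HK.
Unshelve. all: by end_near. Qed.

End StableGenerator.

(** * The travelling wave *)

Unset Implicit Arguments.

Theorem mainTheorem3 (R : realType) (alpha beta : R)
    (halpha : 0 < alpha < 2) (hbeta : -1 < beta < 1)
    (f : R -> R) (hf : stable_density alpha beta f)
    (c tau : R) (htau : 0 < tau) :
  travelling_wave_solution (dom_A alpha f) (opA alpha f) c
    (fun z => c * tau `^ (- alpha^-1) * g0 f z + (alpha * tau)^-1 * g1 f z)
    (fun x t => U_profile alpha f tau (x + c * t)).
Proof.
have alpha0 : 0 < alpha by case/andP: halpha.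
have [cf f0 f1 _] := hf.
have a0 := cos_stable_gt0 halpha hbeta.
have sf := stable_density_law hf.
split; first by exists (U_profile alpha f tau).
move=> t; rewrite /U_profile; set k := tau `^ (- alpha^-1).
have G := profile_is_generator alpha0 a0 sf (c * t) htau.
split; first by eexists; exact: G.
move=> x; set y := (x + c * t) * k.
have du : is_derive t 1 (fun s => cumul f ((x + c * s) * k)) (f y * (c * k)).
  have dy : is_derive t 1 (fun s => (x + c * s) * k) (c * k).
    apply: is_derive_eq (is_derive_mul (is_deriveD (is_derive_cst x t 1)
      (is_derive_linear c t)) (is_derive_cst k t 1)) _.
    by rewrite mulr0 add0r add0r mulrC.
  exact: (@is_derive1_comp R (cumul f) (fun s => (x + c * s) * k) t _ _
    (is_derive_cumul cf f0 f1 _) dy).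
split; first by case: du.
rewrite derive1E (@derive_val _ _ _ _ _ _ _ du) /opA (generatorE G).
rewrite (profile_generatorE alpha0 a0 sf) // -/k -/y mulNr opprK /g0 /g1.
have Fy : cumul f (cumul_inv f (cumul f y)) = cumul f y.
  by apply: pinvK; rewrite inE; exists y.
have [->|[-> ->]] := cumul_level cf f0 f1 Fy; last by rewrite !(mulr0, mul0r).
by rewrite mulrC.
Qed.
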